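(* Let $\mathcal U=(U_i)_{i\in I}$ be an open covering of a manifold $N$, and let $\mathbf G\stackrel{\rho}{\to}\mathbf H$ be a crossed module of Lie groups, with action morphism $\jmath:\mathbf H\to \mathrm{Aut}(\mathbf G)$. (1) Let $(\mathcal U,\bullet,\star)$ be an adapted Lie groupoid $\mathbf G\to\mathbf H$-extension of the Čech groupoid $N[\mathcal U]$. Define maps $\lambda_{ij}:U_{ij}\to\mathbf H$ and $\mathbf g_{ijk}:U_{ijk}\to\mathbf G$ by $$(e,x_{ij})\star(x_j,e)=(x_i,\lambda_{ij}(x))\quad (i,j\in I,\ x\in U_{ij}),\qquad (e,x_{ij})\bullet(e,x_{jk})=(\mathbf g_{ijk}(x),x_{ik})\quad (i,j,k\in I,\ x\in U_{ijk}).$$ Then $(\lambda,\mathbf g)=\big((\lambda_{ij})_{i,j\in I},(\mathbf g_{ijk})_{i,j,k\in I}\big)$ is a $\mathbf G\to\mathbf H$-valued non-Abelian $1$-cocycle w.r.t. $\mathcal U$. (2) Conversely, given a $\mathbf G\to\mathbf H$-valued non-Abelian $1$-cocycle $(\lambda,\mathbf g)$ w.r.t. $\mathcal U$, define: (a) on $\mathcal R=\mathbf G\times\coprod_{i,j\in I}U_{ij}$ the product and inverse $$(g,x_{ij})\bullet(g',x_{jk})=(g\,\lambda_{ij}(g')\,\mathbf g_{ijk},x_{ik}),\qquad (g,x_{ij})^{-1}=(\lambda_{ij}^{-1}(g^{-1}\mathbf g_{iji}^{-1}),x_{ji});$$ (b) the map $\phi:\mathcal R\to N[\mathcal U]$,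 $(g,x_{ij})\mapsto x_{ij}$; (c) on $P=\coprod_{i\in I}U_i\times\mathbf H$, with its right $\mathbf H$-action $(x_i,h)\cdot h'=(x_i,hh')$, the $\mathcal R$-action $(g,x_{ij})\star(x_j,h)=(x_i,\rho(g)\lambda_{ij}h)$; (d) the map $\chi:P\to Band(\mathcal R\to N[\mathcal U])\simeq \mathrm{Aut}(\mathbf G)\times\coprod_{i}U_i$, $(x_i,h)\mapsto(\jmath(h),x_i)$. Then these data define an adapted Lie groupoid $\mathbf G\to\mathbf H$-extension $(\mathcal U,\bullet,\star)$ of the Čech groupoid $N[\mathcal U]$ (in particular $\bullet$ is a Lie groupoid structure on $\mathcal R\rightrightarrows\coprod_i U_i$ and $\star$ makes $P$ an $\mathbf H$-principal bundle over this Lie groupoid). (3) The constructions of (1) and (2) are inverse to each other.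
   Context: Crossed module of Lie groups: $(\mathbf G,\mathbf H,\rho,\jmath)$ with $\mathbf G,\mathbf H$ finite dimensional Lie groups and Lie group morphisms $\rho:\mathbf G\to\mathbf H$, $\jmath:\mathbf H\to\mathrm{Aut}(\mathbf G)$ such that, writing $h(g):=\jmath(h)(g)$, one has $\rho(h(g))=h\rho(g)h^{-1}$ and $\rho(g)(g')=gg'g^{-1}$. Neutral elements of both groups are denoted $e$. Lie groupoids $\Gamma\rightrightarrows M$ have source $s$, target $t$, unit $\epsilon$; the product $x\bullet x'$ is defined when $t(x)=s(x')$. A left action of $\Gamma\rightrightarrows M$ on $\pi:P\to M$: $\gamma\cdot p$ is defined when $t(\gamma)=\pi(p)$, with $\pi(\gamma\cdot p)=s(\gamma)$ and the usual associativity and unit axioms. An $\mathbf H$-principal bundle over $\Gamma\rightrightarrows M$ is a right $\mathbf H$-principal bundle $P\to M$ with a left $\Gamma$-action commuting with the $\mathbf H$-action. Čech groupoid: $U_{ij}=U_i\cap U_j$, $U_{ijk}=U_i\cap U_j\cap U_k$; $x_i$ (resp. $x_{ij}$) denotes $x$ viewed in the copy $U_i$ (resp. $U_{ij}$) of the disjoint union. $N[\mathcal U]$ is $\coprod_{i,j}U_{ij}\rightrightarrows\coprod_iU_i$ with $s(x_{ij})=x_i$, $t(x_{ij})=x_j$, $x_{ij}x_{jk}=x_{ik}$. Lie groupoid extension: a Lie groupoid morphism $\varphi:\mathcal R\to\mathcal G$ over the identity of a common base $M$ that is a surjective submersion. Its kernel is $K=\varphi^{-1}(\epsilon(M))$,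 a bundle of Lie groups; it is a $\mathbf G$-extension if $K$ is locally trivial with typical fibre $\mathbf G$. The band is $Band(\mathcal R\to\mathcal G)=\coprod_{m\in M}\mathrm{Isom}(\mathbf G,K_m)$, an $\mathrm{Aut}(\mathbf G)$-principal bundle over $M$ (right action by precomposition) and over $\mathcal R\rightrightarrows M$ through $(r\cdot b)(g)=r\,b(g)\,r^{-1}$ for $t(r)=m$, $b\in \mathrm{Isom}(\mathbf G,K_m)$. A $\mathbf G\to\mathbf H$-extension of $\mathcal G\rightrightarrows M$ is a triple $(\mathcal R\to\mathcal G,\,P\to M,\,\chi)$ with $\mathcal R\to\mathcal G$ a $\mathbf G$-extension, $P\to M$ an $\mathbf H$-principal bundle over $\mathcal R\rightrightarrows M$, and $\chi:P\to Band(\mathcal R\to\mathcal G)$ a smooth map over $\mathrm{id}_M$ with $\chi(r\cdot p\cdot h)=r\cdot\chi(p)\cdot\jmath(h)$, such that $p\cdot\rho(g)=\chi(p)(g)\cdot p$ for all $p\in P$, $g\in\mathbf G$ (where $\chi(p)(g)\in K\subset\mathcal R$ acts on $p$). An adapted $\mathbf G\to\mathbf H$-extension of $N[\mathcal U]$ is a $\mathbf G\to\mathbf H$-extension $(\mathcal R\stackrel{\varphi}{\to}N[\mathcal U],P,\chi)$ with: $\mathcal R=\mathbf G\times\coprod_{i,j}U_{ij}$ as a manifold and $\varphi$ the projection; $P=\coprod_iU_i\times\mathbf H$ with $(x_i,h)\cdot h'=(x_i,hh')$; $\chi(x_i,h)$ is $g\mapsto(h(g),x_{ii})$; and $(g,x_{ii})\bullet(g',x_{ij})=(gg',x_{ij})$.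 It is denoted $(\mathcal U,\bullet,\star)$, with $\bullet$ the product of $\mathcal R$ and $\star$ the action of $\mathcal R$ on $P$. A $\mathbf G\to\mathbf H$-valued non-Abelian $1$-cocycle w.r.t. $\mathcal U$ is a pair $(\lambda,\mathbf g)\in C^\infty(\coprod_{i,j}U_{ij},\mathbf H)\times C^\infty(\coprod_{i,j,k}U_{ijk},\mathbf G)$ with $\rho(\mathbf g_{ijk})\lambda_{ik}=\lambda_{ij}\lambda_{jk}$, $\ \mathbf g_{ijk}\mathbf g_{ikl}=\lambda_{ij}(\mathbf g_{jkl})\mathbf g_{ijl}$, $\ \mathbf g_{iik}=e$ for all indices (on the relevant intersections). *)

(* Defs.v *)
From HB Require Import structures.
From mathcomp Require Import all_boot all_order all_algebra.
From mathcomp Require Import all_classical all_reals.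
From mathcomp Require Import topology normedtype derive.
Import numFieldNormedType.Exports.

Set Implicit Arguments.
Unset Strict Implicit.
Unset Printing Implicit Defensive.

Local Open Scope classical_set_scope.

(* [Ck k W f]: f is of class C^k on the open set W. *)
Fixpoint Ck (R : realType) (V V' : normedModType R) (k : nat) (W : set V)
    (f : V -> V') : Prop :=
  if k is k'.+1 then
    (forall x, W x -> differentiable f x) /\
    (forall v, Ck k' W (fun x => 'D_v f x))
  else forall x, W x -> {for x, continuous f}.

Definition Cinfty (R : realType) (V V' : normedModType R) (W : set V)
    (f : V -> V') : Prop := forall k, Ck k W f.

(* The value of [chart_map] outside [chart_dom] is irrelevant. *)
Record chart (R : realType) (T : Type) (n : nat) := Chart {
  chart_dom : set T;
  chart_map :> T -> 'rV[R]_n }.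

HB.mixin Record hasAtlas (R : realType) T of Topological T := {
  mdim : nat;
  atlas : set (chart R T mdim) }.

#[short(type="atlasType")]
HB.structure Definition AtlasSpace (R : realType) :=
  {T of Topological T & hasAtlas R T}.

Definition is_chart (R : realType) (T : topologicalType) (n : nat)
    (c : chart R T n) : Prop :=
  [/\ open (chart_dom c),
      {in chart_dom c &, injective c},
      forall x, chart_dom c x -> {for x, continuous c} &
      forall O : set T, open O -> O `<=` chart_dom c -> open (c @` O)].

(* No countability axiom, so that arbitrary coproducts are manifolds. *)
Definition is_manifold (R : realType) (T : atlasType R) : Prop :=
  [/\ hausdorff_space T,
      forall p : T, exists2 c, atlas c & chart_dom c p,
      forall c : chart R T mdim, atlas c -> is_chart c &
      forall c c' : chart R T mdim, atlas c -> atlas c' ->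
        exists2 F : 'rV[R]_(@mdim R T) -> 'rV[R]_(@mdim R T),
          Cinfty (c @` (chart_dom c `&` chart_dom c')) F &
          forall p, chart_dom c p -> chart_dom c' p -> F (c p) = c' p].

HB.mixin Record isManifold (R : realType) T of AtlasSpace R T := {
  manifold_axiom : is_manifold T }.

#[short(type="manifoldType")]
HB.structure Definition Manifold (R : realType) :=
  {T of AtlasSpace R T & isManifold R T}.

(* The map F is f read in the charts c, c' on the neighbourhood W of c p. *)
Definition local_rep (R : realType) (T T' : atlasType R) (f : T -> T') (p : T)
    (c : chart R T mdim) (c' : chart R T' mdim)
    (W : set 'rV[R]_(@mdim R T))
    (F : 'rV[R]_(@mdim R T) -> 'rV[R]_(@mdim R T')) : Prop :=
  [/\ atlas c /\ atlas c', chart_dom c p, open W /\ W (c p), Cinfty W F &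
      forall q, chart_dom c q -> W (c q) ->
        chart_dom c' (f q) /\ c' (f q) = F (c q)].

Definition smooth_at (R : realType) (T T' : atlasType R) (f : T -> T') (p : T)
  : Prop := exists c c' W F, local_rep f p c c' W F.

Definition smooth_on (R : realType) (T T' : atlasType R) (D : set T)
    (f : T -> T') : Prop := forall p, D p -> smooth_at f p.

Definition smooth (R : realType) (T T' : atlasType R) (f : T -> T') : Prop :=
  smooth_on setT f.

(* Smoothness of a map defined only on a subset D, through local smooth
   extensions to the ambient manifold; when D is an embedded submanifold this
   is smoothness for the submanifold structure. *)
Definition smooth_partial (R : realType) (T T' : atlasType R) (D : set T)
    (f : forall p, D p -> T') : Prop :=
  forall p, D p -> exists2 F : T -> T', smooth_at F p &
    \forall q \near p, forall Dq : D q, F q = f q Dq.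

Definition submersion (R : realType) (T T' : atlasType R) (f : T -> T')
  : Prop :=
  forall p, exists c c' W F, local_rep f p c c' W F /\
    forall w, exists v, 'd F (c p) v = w.

Definition prod_chart (R : realType) (T T' : Type) (n n' : nat)
    (c : chart R T n) (c' : chart R T' n') : chart R (T * T') (n + n') :=
  Chart (chart_dom c `*` chart_dom c') (fun p => row_mx (c p.1) (c' p.2)).

Definition prod_atlas (R : realType) (T T' : atlasType R)
  : set (chart R (T * T') (@mdim R T + @mdim R T')) :=
  [set e | exists c c', [/\ atlas c, atlas c' & e = prod_chart c c']].

HB.instance Definition _ (R : realType) (T T' : atlasType R) :=
  hasAtlas.Build R (T * T')%type (@prod_atlas R T T').

Definition coprod (J : choiceType) (T : Type) (V : J -> set T) : Type :=
  {j : J & V j}.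

Section Coprod.
Variables (J : choiceType) (T : Type) (V : J -> set T).

Definition coprod_in (j : J) (x : T) (h : V j x) : coprod V :=
  existT (fun j => set_type (V j)) j (exist _ x (mem_set h)).

Definition coprod_idx (u : coprod V) : J := projT1 u.
Definition coprod_pt (u : coprod V) : T := set_val (projT2 u).

Lemma coprod_ptP (u : coprod V) : V (coprod_idx u) (coprod_pt u).
Proof. exact: set_valP. Qed.

End Coprod.

HB.instance Definition _ (J : choiceType) (T : topologicalType)
  (V : J -> set T) := Topological.copy (coprod V) {j : J & V j}.

Definition coprod_chart (R : realType) (J : choiceType) (T : Type)
    (V : J -> set T) (n : nat) (j : J) (c : chart R T n)
  : chart R (coprod V) n :=
  Chart [set u | coprod_idx u = j /\ chart_dom c (coprod_pt u)]
    (fun u => c (coprod_pt u)).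

Definition coprod_atlas (R : realType) (J : choiceType) (T : atlasType R)
    (V : J -> set T) : set (chart R (coprod V) (@mdim R T)) :=
  [set e | exists j, exists2 c, atlas c & e = coprod_chart V j c].

HB.instance Definition _ (R : realType) (J : choiceType) (T : atlasType R)
  (V : J -> set T) := hasAtlas.Build R (coprod V) (@coprod_atlas R J T V).

HB.mixin Record isLieGroup (R : realType) G of Group G & Manifold R G := {
  smooth_mulg : smooth (fun p : G * G => (p.1 * p.2)%g);
  smooth_invg : smooth (fun g : G => (g^-1)%g) }.

#[short(type="lieGroupType")]
HB.structure Definition LieGroup (R : realType) :=
  {G of Group G & Manifold R G & isLieGroup R G}.

Definition lie_aut (R : realType) (G : lieGroupType R) (f : G -> G) : Prop :=
  [/\ forall x y, f (x * y)%g = (f x * f y)%g, smooth f &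
      exists2 f', smooth f' & cancel f f' /\ cancel f' f].

(* Smoothness of jmath : H -> Aut(G) is smoothness of the map H x G -> G. *)
Record crossed_module (R : realType) (G H : lieGroupType R) := CrossedModule {
  rho : G -> H;
  jmath : H -> G -> G;
  rhoM : forall g g', rho (g * g')%g = (rho g * rho g')%g;
  smooth_rho : smooth rho;
  jmath_aut : forall h, lie_aut (jmath h);
  jmathM : forall h h' g, jmath (h * h')%g g = jmath h (jmath h' g);
  smooth_jmath : smooth (fun p : H * G => jmath p.1 p.2);
  rho_jmath : forall h g, rho (jmath h g) = (h * rho g * h^-1)%g;
  jmath_rho : forall g g', jmath (rho g) g' = (g * g' * g^-1)%g }.

(* The product a . b is defined exactly when t a = s b. *)
Record groupoid_data (A M : Type) (s t : A -> M) := GroupoidData {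
  gunit : M -> A;
  gmul : forall a b, t a = s b -> A;
  ginv : A -> A }.

(* Below, an equation between iterated products is required for all proofs
   that its factors are composable; such proofs exist by the other axioms. *)
Record groupoid_axioms (A M : Type) (s t : A -> M) (D : groupoid_data s t)
  : Prop := GroupoidAxioms {
  src_unit : forall m, s (gunit D m) = m;
  tgt_unit : forall m, t (gunit D m) = m;
  src_mul : forall a b (h : t a = s b), s (gmul D h) = s a;
  tgt_mul : forall a b (h : t a = s b), t (gmul D h) = t b;
  src_inv : forall a, s (ginv D a) = t a;
  tgt_inv : forall a, t (ginv D a) = s a;
  gmulA : forall a b c (hab : t a = s b) (hbc : t b = s c)
    (h : t a = s (gmul D hbc)) (h' : t (gmul D hab) = s c),
    gmul D h = gmul D h';
  gmul1 : forall a m (h : t a = s (gunit D m)), gmul D h = a;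
  g1mul : forall a m (h : t (gunit D m) = s a), gmul D h = a;
  gmulV : forall a (h : t a = s (ginv D a)), gmul D h = gunit D (s a);
  gVmul : forall a (h : t (ginv D a) = s a), gmul D h = gunit D (t a) }.

Definition lie_groupoid (R : realType) (A M : atlasType R) (s t : A -> M)
    (D : groupoid_data s t) : Prop :=
  (is_manifold A /\ is_manifold M) /\ groupoid_axioms D /\
  [/\ submersion s, submersion t, smooth (gunit D), smooth (ginv D) &
      smooth_partial (D := [set p : A * A | t p.1 = s p.2])
        (fun p h => gmul D h)].

Section Extensions.
Variables (R : realType) (G H : lieGroupType R) (X : crossed_module G H).
(* A => M is the extension, B => M the groupoid that is extended. *)
Variables (A B M : atlasType R).
Variables (sA tA : A -> M) (DA : groupoid_data sA tA).
Variables (sB tB : B -> M) (DB : groupoid_data sB tB).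
Variable phi : A -> B.

Definition groupoid_morphism_over_id : Prop :=
  [/\ smooth phi,
      forall a, sB (phi a) = sA a,
      forall a, tB (phi a) = tA a,
      forall m, phi (gunit DA m) = gunit DB m &
      forall a a' (h : tA a = sA a') (h' : tB (phi a) = sB (phi a')),
        phi (gmul DA h) = gmul DB h'].

Definition lie_groupoid_extension : Prop :=
  [/\ lie_groupoid DA, lie_groupoid DB, groupoid_morphism_over_id,
      submersion phi & forall b, exists a, phi a = b].

Definition kernel_at (m : M) : set A := [set a | phi a = gunit DB m].

(* b belongs to Isom(G, K_m), i.e. to the fibre of the band over m. *)
Definition band_at (m : M) (b : G -> A) : Prop :=
  [/\ forall g, kernel_at m (b g),
      forall g g' (h : tA (b g) = sA (b g')), gmul DA h = b (g * g')%g,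
      smooth b &
      exists b' : A -> G, [/\ forall g, b' (b g) = g,
        forall a, kernel_at m a -> b (b' a) = a &
        smooth_partial (D := kernel_at m) (fun a _ => b' a)]].

Definition kernel_locally_trivial : Prop :=
  forall m, exists (V : set M) (tau : M -> G -> A) (tau' : A -> G),
    [/\ open V /\ V m,
        forall x, V x -> band_at x (tau x),
        smooth_on (V `*` setT) (fun p : M * G => tau p.1 p.2),
        forall x g, V x -> tau' (tau x g) = g &
        smooth_partial (D := \bigcup_(x in V) kernel_at x)
          (fun a _ => tau' a)].

Definition G_extension : Prop :=
  lie_groupoid_extension /\ kernel_locally_trivial.

Variables (P : atlasType R) (pi : P -> M) (ract : P -> H -> P).
Variable lact : forall a p, tA a = pi p -> P.

Definition principal_bundle : Prop :=
  [/\ is_manifold P /\ is_manifold M,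
      smooth pi,
      smooth (fun q : P * H => ract q.1 q.2),
      (forall p, ract p 1%g = p) /\
      (forall p h h', ract (ract p h) h' = ract p (h * h')%g) &
      forall m, exists (V : set M) (theta : P -> H) (psi : M * H -> P),
        [/\ open V /\ V m,
            smooth_on (pi @^-1` V) theta /\ smooth_on (V `*` setT) psi,
            forall p, V (pi p) -> psi (pi p, theta p) = p,
            forall x h, V x -> pi (psi (x, h)) = x /\ theta (psi (x, h)) = h &
            forall p h, V (pi p) ->
              pi (ract p h) = pi p /\ theta (ract p h) = (theta p * h)%g]].

Definition principal_bundle_over : Prop :=
  principal_bundle /\
  [/\ forall a p (h : tA a = pi p), pi (lact h) = sA a,
      forall m p (h : tA (gunit DA m) = pi p), lact h = p,
      forall a a' p (haa : tA a = sA a') (hap : tA a' = pi p)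
        (h : tA (gmul DA haa) = pi p) (h' : tA a = pi (lact hap)),
        lact h = lact h',
      smooth_partial (D := [set q : A * P | tA q.1 = pi q.2])
        (fun q h => lact h) &
      forall a p (k : H) (hap : tA a = pi p) (h : tA a = pi (ract p k)),
        lact h = ract (lact hap) k].

(* A smooth map chi : P -> Band over the identity of M is given by the map
   (p, g) |-> chi p g from P x G to A. *)
Definition band_map (chi : P -> G -> A) : Prop :=
  [/\ forall p, band_at (pi p) (chi p),
      smooth (fun q : P * G => chi q.1 q.2) &
      forall a p (k : H) g (hap : tA a = pi p)
        (h : tA a = sA (chi p (jmath X k g)))
        (h' : tA (gmul DA h) = sA (ginv DA a)),
        chi (ract (lact hap) k) g = gmul DA h'].

Definition GH_extension (chi : P -> G -> A) : Prop :=
  [/\ G_extension, principal_bundle_over, band_map chi &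
      forall p g (h : tA (chi p g) = pi p), ract p (rho X g) = lact h].

End Extensions.

Definition open_cover (T : topologicalType) (I : Type) (U : I -> set T) :=
  (forall i, open (U i)) /\ \bigcup_i U i = setT.

Section Cech.
Variables (R : realType) (N : manifoldType R) (I : choiceType).
Variable U : I -> set N.

Definition cech0 := coprod U.
Definition cech1 := coprod (fun ij : I * I => U ij.1 `&` U ij.2).
Definition cech2 :=
  coprod (fun ijk : I * I * I => U ijk.1.1 `&` U ijk.1.2 `&` U ijk.2).

(* x_i, x_ij and x_ijk *)
Definition pt0 i x (hi : U i x) : cech0 := coprod_in hi.
Definition pt1 i j x (hi : U i x) (hj : U j x) : cech1 :=
  @coprod_in _ _ (fun ij : I * I => U ij.1 `&` U ij.2) (i, j) x (conj hi hj).
Definition pt2 i j k x (hi : U i x) (hj : U j x) (hk : U k x) : cech2 :=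
  @coprod_in _ _
    (fun ijk : I * I * I => U ijk.1.1 `&` U ijk.1.2 `&` U ijk.2)
    (i, j, k) x (conj (conj hi hj) hk).

Definition in_fst (c : cech1) : U (coprod_idx c).1 (coprod_pt c) :=
  proj1 (coprod_ptP c).
Definition in_snd (c : cech1) : U (coprod_idx c).2 (coprod_pt c) :=
  proj2 (coprod_ptP c).

Definition cech_src (c : cech1) : cech0 := pt0 (in_fst c).
Definition cech_tgt (c : cech1) : cech0 := pt0 (in_snd c).

Lemma in_last (c c' : cech1) :
  cech_tgt c = cech_src c' -> U (coprod_idx c').2 (coprod_pt c).
Proof.
move=> e; have -> : coprod_pt c = coprod_pt c' := congr1 (@coprod_pt _ _ _) e.
exact: in_snd.
Qed.

Definition cech_groupoid : groupoid_data cech_src cech_tgt := {|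
  gunit := fun m => pt1 (coprod_ptP m) (coprod_ptP m);
  gmul := fun c c' e => pt1 (in_fst c) (in_last e);
  ginv := fun c => pt1 (in_snd c) (in_fst c) |}.

Lemma pt1_composable i j k x (hi : U i x) (hj : U j x) (hk : U k x) :
  cech_tgt (pt1 hi hj) = cech_src (pt1 hj hk).
Proof. by congr coprod_in; exact: Prop_irrelevance. Qed.

Section Adapted.
Variables (G H : lieGroupType R) (X : crossed_module G H).

Record cocycle_data := CocycleData {
  clambda : cech1 -> H;
  cg : cech2 -> G }.

Definition cocycle (L : cocycle_data) : Prop :=
  [/\ smooth (clambda L) /\ smooth (cg L),
      forall i j k x (hi : U i x) (hj : U j x) (hk : U k x),
        (rho X (cg L (pt2 hi hj hk)) * clambda L (pt1 hi hk) =
         clambda L (pt1 hi hj) * clambda L (pt1 hj hk))%g,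
      forall i j k l x (hi : U i x) (hj : U j x) (hk : U k x) (hl : U l x),
        (cg L (pt2 hi hj hk) * cg L (pt2 hi hk hl) =
         jmath X (clambda L (pt1 hi hj)) (cg L (pt2 hj hk hl)) *
         cg L (pt2 hi hj hl))%g &
      forall i k x (hi : U i x) (hk : U k x), cg L (pt2 hi hi hk) = 1%g].

(* The prescribed total spaces of the extension and of the H-bundle. *)
Definition ext_arrows := (G * cech1)%type.
Definition ext_bundle := (cech0 * H)%type.

Definition ext_proj (r : ext_arrows) : cech1 := r.2.
(* Forced by the projection being a groupoid morphism over the identity. *)
Definition ext_src (r : ext_arrows) : cech0 := cech_src r.2.
Definition ext_tgt (r : ext_arrows) : cech0 := cech_tgt r.2.

Definition bundle_proj (p : ext_bundle) : cech0 := p.1.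
Definition bundle_ract (p : ext_bundle) (h : H) : ext_bundle :=
  (p.1, (p.2 * h)%g).
Definition ext_chi (p : ext_bundle) (g : G) : ext_arrows :=
  (jmath X p.2 g, pt1 (coprod_ptP p.1) (coprod_ptP p.1)).

Record adapted_data := AdaptedData {
  ad_gpd : groupoid_data ext_src ext_tgt;
  ad_star : forall (r : ext_arrows) (p : ext_bundle),
    ext_tgt r = bundle_proj p -> ext_bundle }.

Definition adapted_extension (E : adapted_data) : Prop :=
  GH_extension X (ad_gpd E) cech_groupoid ext_proj bundle_ract (@ad_star E)
    ext_chi /\
  forall i j x (hi : U i x) (hj : U j x) (g g' : G)
    (e : ext_tgt (g, pt1 hi hi) = ext_src (g', pt1 hi hj)),
    gmul (ad_gpd E) e = ((g * g')%g, pt1 hi hj).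

Definition cocycle_of (E : adapted_data) : cocycle_data := {|
  clambda := fun c =>
    (ad_star E (r := (1%g, c)) (p := (cech_tgt c, 1%g)) erefl).2;
  cg := fun c =>
    let hi := proj1 (proj1 (coprod_ptP c)) in
    let hj := proj2 (proj1 (coprod_ptP c)) in
    let hk := proj2 (coprod_ptP c) in
    (gmul (ad_gpd E) (a := (1%g, pt1 hi hj)) (b := (1%g, pt1 hj hk))
       (pt1_composable hi hj hk)).1 |}.

Definition extension_of (L : cocycle_data) : adapted_data := {|
  ad_gpd := {|
    gunit := fun m => (1%g, pt1 (coprod_ptP m) (coprod_ptP m));
    gmul := fun (r r' : ext_arrows) (e : ext_tgt r = ext_src r') =>
      ((r.1 * jmath X (clambda L r.2) r'.1 *
        cg L (pt2 (in_fst r.2) (in_snd r.2) (in_last e)))%g,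
       pt1 (in_fst r.2) (in_last e));
    ginv := fun r =>
      (jmath X (clambda L r.2)^-1%g
         (r.1^-1 * (cg L (pt2 (in_fst r.2) (in_snd r.2) (in_fst r.2)))^-1)%g,
       pt1 (in_snd r.2) (in_fst r.2)) |};
  ad_star := fun r p _ =>
    (cech_src r.2, (rho X r.1 * clambda L r.2 * p.2)%g) |}.

End Adapted.
End Cech.

(* Main.v *)
Require Import Defs.
From HB Require Import structures.
From mathcomp Require Import all_boot all_order all_algebra.
From mathcomp Require Import all_classical all_reals.
From mathcomp Require Import topology normedtype landau derive.
Import numFieldNormedType.Exports.
Import GRing.Theory.

(** An arrow (g, x_ij) of an adapted extension factors as
    (g, x_ii) . (e, x_ij), where products by (g, x_ii) on the left are
    prescribed. What remains to be known is how (e, x_ij) moves past an element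
    (g, x_jj) of the kernel. The compatibility of chi with the actions says
    that conjugation by (e, x_ij) carries chi(x_j, e) to
    (e, x_ij) . chi(x_j, e) = chi(x_i, lambda_ij), that is, acts on G as
    jmath(lambda_ij) ([product_jmath]). Hence the product and the action of
    every adapted extension are given by
      (g, x_ij) . (g', x_jk) = (g lambda_ij(g') g_ijk, x_ik),
      (g, x_ij) * (x_j, h) = (x_i, rho(g) lambda_ij h)
    ([product_formula], [action_formula]), which are the formulas that define
    the extension attached to a cocycle.

    With these formulas each cocycle identity is an axiom read off on the
    arrows (e, x_ij): the relation between rho(g_ijk) and lambda is the
    associativity of the action, the relation between the g_ijk is the
    associativity of the product, and g_iik = e is part of being adapted
    ([cocycle_of_cocycle]). Conversely the cocycle identities, together with
    their consequences lambda_ii = e, g_ijj = e and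
    lambda_ij(g_jij) = g_iji, give all the axioms of an extension
    ([extension_groupoid_axioms], [extension_of_adapted]). The two
    constructions are inverse to each other because an extension is determined
    by its product and its action: the unit over x_i is the only idempotent
    (g, x_ii), and inverses in a groupoid are unique
    ([extension_of_cocycle_of]).

    The differential part rests on the stability of C^k maps under
    composition, proved by induction on k from the chain rule written in
    coordinates, D_v (g o f) = sum_j (D_v f)_j (D_(e_j) g o f) ([Ck_comp]).
    Through the transition maps this makes smooth maps of manifolds stable
    under composition ([smooth_at_comp]). Products of manifolds and coproducts
    of open subsets of a manifold are manifolds ([is_manifold_prod],
    [is_manifold_coprod]), and the structure maps of a Cech groupoid, which
    keep the point and change the indices, are the identity in charts
    ([local_rep_reindex]). A product of composable arrows extends smoothly to
    all pairs near a given composable one, by freezing the indices and reading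
    the point off the first arrow ([smooth_ext_mul]); in the other direction a
    partially defined smooth map is smooth along any smooth map into its
    domain ([smooth_partial_along]), which gives the smoothness of lambda and
    of the g_ijk. *)

Set Implicit Arguments.
Unset Strict Implicit.
Unset Printing Implicit Defensive.

Local Open Scope classical_set_scope.
Local Open Scope group_scope.

(** * C^k maps between normed spaces *)

Section CkTheory.
Variable R : realType.
Local Open Scope ring_scope.

(** The first order expansion of f at x only sees the values of f near x,
    so the differential of f at x also serves for g. *)
Lemma near_eq_differentiable (V V' : normedModType R) (f g : V -> V') x :
  (\forall y \near x, f y = g y) -> differentiable f x -> differentiable g x.
Proof.
move=> fg df.
have gE : g \o shift x = cst (g x) + 'd f x +o_ 0 id.
  have [_ /eqaddoP fE] := (diff_locallyP x f).1 df.
  apply/eqaddoP => e e0; have := fE _ e0.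
  have fg0 : \forall y \near (0 : V), f (y + x) = g (y + x).
    by move: fg; rewrite (near_shift 0 x)/=; apply: filterS => y /=; rewrite subr0.
  apply: filterS2 fg0 => y fgy.
  by rewrite !fctE /= fgy (nbhs_singleton fg).
have cf := diff_continuous df.
by apply/diff_locallyP; rewrite (diff_unique cf gE).
Qed.

Lemma Ck_sub (V V' : normedModType R) k (W W' : set V) (f : V -> V') :
  W' `<=` W -> Ck k W f -> Ck k W' f.
Proof.
elim: k f => [|k IH] f WW' /=; first by move=> + x /WW'; exact.
by move=> [df Df]; split=> [x /WW'/df|v]//; exact: IH.
Qed.

Lemma CkS (V V' : normedModType R) k (W : set V) (f : V -> V') :
  Ck k.+1 W f -> Ck k W f.
Proof.
elim: k f => [|k IH] f [df Df]; first by move=> x /df/differentiable_continuous.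
by split=> // v; exact/IH/Df.
Qed.

(** The rules for directional derivatives hold at the points of W only. As W
    is open, they hold near each of these points, and this is all that the
    next derivative depends on. *)
Lemma Ck_ext (V V' : normedModType R) k (W : set V) (f g : V -> V') :
  open W -> (forall x, W x -> f x = g x) -> Ck k W f -> Ck k W g.
Proof.
move=> oW; elim: k f g => [|k IH] f g fg /= Cf.
  move=> x Wx; rewrite /prop_for /continuous_at -(fg _ Wx).
  apply: cvg_trans (Cf x Wx); apply: near_eq_cvg.
  by apply: filterS fg _; exact: open_nbhs_nbhs.
have fgn x : W x -> \forall y \near x, f y = g y.
  by move=> Wx; apply: filterS fg _; exact: open_nbhs_nbhs.
case: Cf => df Df; split=> [x Wx|v].
  by apply: near_eq_differentiable (df x Wx); exact: fgn.
apply: IH (Df v) => x Wx; apply: near_eq_derive; exact: fgn.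
Qed.

Lemma Ck_cst (V V' : normedModType R) k (W : set V) (w : V') :
  Ck k W (fun=> w).
Proof.
elim: k w => [|k IH] w /=; first by move=> x _; exact: cst_continuous.
split=> [x _|v]; first exact: differentiable_cst.
suff -> : (fun x : V => 'D_v (fun=> w) x) = fun=> 0 by exact: IH.
by apply/funext => x; rewrite derive_cst.
Qed.

Lemma CkD (V V' : normedModType R) k (W : set V) (f g : V -> V') :
  open W -> Ck k W f -> Ck k W g -> Ck k W (fun x => f x + g x).
Proof.
move=> oW; elim: k f g => [|k IH] f g /= Cf Cg.
  by move=> x Wx; apply: continuousD; [exact: Cf|exact: Cg].
case: Cf => df Df; case: Cg => dg Dg; split=> [x Wx|v].
  by apply: (@differentiableD _ _ _ f g); [exact: df|exact: dg].
apply: Ck_ext (IH _ _ (Df v) (Dg v)) => // x Wx.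
by rewrite -deriveD//; apply: diff_derivable; [exact: df|exact: dg].
Qed.

Lemma Ck_sum (V V' : normedModType R) k (W : set V) n (f : 'I_n -> V -> V') :
  open W -> (forall i, Ck k W (f i)) -> Ck k W (fun x => \sum_(i < n) f i x).
Proof.
move=> oW Cf; elim: n f Cf => [|n IH] f Cf.
  have -> : (fun x => \sum_(i < 0) f i x) = fun=> 0.
    by apply/funext => x; rewrite big_ord0.
  exact: Ck_cst.
have -> : (fun x => \sum_(i < n.+1) f i x) =
    fun x => f ord0 x + \sum_(i < n) f (lift ord0 i) x.
  by apply/funext => x; rewrite big_ord_recl.
by apply: CkD => //; apply: IH.
Qed.

Lemma Ck_lin (V V' V'' : normedModType R) k (W : set V) (f : V -> V')
    (L : {linear V' -> V''}) :
  open W -> continuous L -> Ck k W f -> Ck k W (fun x => L (f x)).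
Proof.
move=> oW cL; elim: k f => [|k IH] f /= Cf.
  by move=> x Wx; apply: continuous_comp; [exact: Cf|exact: cL].
have dL y : differentiable L y by exact: linear_differentiable.
case: Cf => df Df; split=> [x Wx|v].
  by apply: (@differentiable_comp _ _ _ _ f L) => //; exact: df.
apply: Ck_ext (IH _ (Df v)) => // x Wx.
have dfx := df x Wx.
rewrite !deriveE//; last exact: (@differentiable_comp _ _ _ _ f L).
by rewrite (@diff_comp _ _ _ _ f L)//= diff_lin.
Qed.

Lemma CkM (V : normedModType R) k (W : set V) (f g : V -> R) :
  open W -> Ck k W f -> Ck k W g -> Ck k W (fun x => f x * g x).
Proof.
move=> oW; elim: k f g => [|k IH] f g Cf Cg.
  by move=> x Wx; apply: (@continuousM _ _ f g); [exact: Cf|exact: Cg].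
have [Cf' Cg'] := (CkS Cf, CkS Cg).
case: Cf => df Df; case: Cg => dg Dg; split=> [x Wx|v].
  by apply: (@differentiableM _ _ f g); [exact: df|exact: dg].
apply: Ck_ext (CkD oW (IH _ _ Cf' (Dg v)) (IH _ _ Cg' (Df v))) => // x Wx.
by rewrite -deriveM//; apply: diff_derivable; [exact: df|exact: dg].
Qed.

(** Reduces vector valued maps to scalar valued ones, for which products are
    available: coordinates are continuous linear forms, and f is the sum of
    its coordinates times the basis vectors. *)
Lemma Ck_coord (V : normedModType R) k (W : set V) n (f : V -> 'rV[R]_n) :
  open W -> Ck k W f <-> forall j, Ck k W (fun x => f x 0 j).
Proof.
move=> oW; split=> [Cf j|Cf].
  have lc : linear (fun u : 'rV[R]_n => u 0 j) by move=> a u v; rewrite !mxE.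
  pose cM := GRing.isLinear.Build _ _ _ _ _ lc.
  pose c : {linear 'rV[R]_n -> R} := HB.pack (fun u : 'rV[R]_n => u 0 j) cM.
  by apply: (@Ck_lin _ _ _ _ _ _ c) => //; exact: coord_continuous.
have -> : f = fun x => \sum_(j < n) f x 0 j *: delta_mx 0 j.
  by apply/funext => x; exact: row_sum_delta.
apply: Ck_sum => // j; set e := delta_mx _ _.
have ls : linear (fun a : R => a *: e).
  by move=> u y z; rewrite scalerDl scalerA.
pose sM := GRing.isLinear.Build _ _ _ _ _ ls.
pose s : {linear R -> 'rV[R]_n} := HB.pack (fun a : R => a *: e) sM.
by apply: (@Ck_lin _ _ _ _ _ _ s) => //; exact: scalel_continuous.
Qed.

(** In coordinates of the intermediate space the chain rule reads
    D_v (g o f) = sum_j (D_v f)_j (D_(e_j) g o f), where g is differentiated in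
    constant directions only; so the right hand side falls under the induction
    hypothesis. *)
Lemma Ck_comp (V : normedModType R) k n m (W : set V) (W' : set 'rV[R]_n)
    (f : V -> 'rV[R]_n) (g : 'rV[R]_n -> 'rV[R]_m) :
  open W -> open W' -> (forall x, W x -> W' (f x)) ->
  Ck k W f -> Ck k W' g -> Ck k W (fun x => g (f x)).
Proof.
move=> oW oW' WW' Cf; rewrite (Ck_coord _ _ oW') (Ck_coord _ _ oW).
suff sc (h : 'rV[R]_n -> R) : Ck k W' h -> Ck k W (fun x => h (f x)).
  by move=> Cg j; exact: (sc (fun y => g y 0 j)).
elim: k h Cf => [|k IH] h Cf Ch.
  by move=> x Wx; apply: continuous_comp; [exact: Cf|exact/Ch/WW'].
have {}IH h' := IH h' (CkS Cf).
case: Cf => df Df; case: Ch => dh Dh; split=> [x Wx|v].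
  by apply: (@differentiable_comp _ _ _ _ f h); [exact: df|exact/dh/WW'].
have CD : Ck k W
    (fun x => \sum_(j < n) 'D_v f x 0 j * 'D_(delta_mx 0 j) h (f x)).
  apply: Ck_sum => // j; apply: CkM => //; first
    exact: ((Ck_coord k (fun x => 'D_v f x) oW).1 (Df v) j).
  exact: (IH (fun y => 'D_(delta_mx 0 j) h y) (Dh _)).
apply: Ck_ext CD => // x Wx.
have dfx := df x Wx; have dhx := dh _ (WW' _ Wx).
rewrite (deriveE _ (differentiable_comp dfx dhx)) (diff_comp dfx dhx)/=.
rewrite -(deriveE _ dfx) [in RHS](row_sum_delta ('D_v f x)) linear_sum.
by apply: eq_bigr => j _; rewrite (deriveE (delta_mx 0 j) dhx) linearZ.
Qed.

End CkTheory.

(** * Smooth maps between manifolds *)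

Section SmoothMaps.
Variable R : realType.
Local Open Scope ring_scope.

Lemma near_mem (T : topologicalType) (O : set T) x :
  open O -> O x -> nbhs x O.
Proof. by move=> oO Ox; exact: open_nbhs_nbhs. Qed.

Lemma open_preimage_on (T T' : topologicalType) (W : set T) (f : T -> T')
    (O : set T') :
  open W -> (forall x, W x -> {for x, continuous f}) -> open O ->
  open (W `&` f @^-1` O).
Proof.
move=> oW cf oO; rewrite openE => x [Wx Ofx].
apply: filterI; first exact: near_mem.
exact: (cf x Wx) (near_mem oO Ofx).
Qed.

Lemma chart_open_image (T : atlasType R) (c : chart R T mdim) (O : set T) :
  is_manifold T -> atlas c -> open O -> open (c @` (chart_dom c `&` O)).
Proof.
move=> [_ _ ch _] /ch[oc _ _ im] oO; apply: im; first exact: openI.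
by move=> x [].
Qed.

(** The representative of f ends in a chart c' and the one of g starts in a
    chart d, possibly different; the transition map from c' to d goes in
    between. *)
Lemma local_rep_comp (T T' T'' : atlasType R) (f : T -> T') (g : T' -> T'') p
    c c' W F d d' W' F' :
  is_manifold T' -> local_rep f p c c' W F -> local_rep g (f p) d d' W' F' ->
  exists W'' F'', local_rep (fun x => g (f x)) p c d' W'' F''.
Proof.
move=> mT' [[ac ac'] cp [oW Wp] CF repF] [[ad ad'] dfp [oW' W'fp] CF' repF'].
have [_ _ ch tr] := mT'.
have [tau Ctau tauE] := tr c' d ac' ad.
have [_ injc' _ _] := ch _ ac'; have [od _ _ _] := ch _ ad.
set O := c' @` (chart_dom c' `&` chart_dom d).
have oO : open O by exact: chart_open_image.
pose O' := O `&` tau @^-1` W'.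
have oO' : open O' by apply: open_preimage_on => //; exact: (Ctau 0%N).
have oW'' : open (W `&` F @^-1` O').
  by apply: open_preimage_on => //; exact: (CF 0%N).
have [c'fp Fcp] := repF p cp Wp.
exists (W `&` F @^-1` O'), (fun x => F' (tau (F x))).
split=> //.
- split=> //; split=> //; rewrite /= -Fcp; split; first by exists (f p).
  by rewrite /= tauE.
- move=> k; apply: (Ck_comp (W' := W') (f := fun x => tau (F x))) => //.
  + by move=> x [_ []].
  + apply: (Ck_comp (W' := O') (f := F)) => //.
    * by move=> x [].
    * by apply: Ck_sub (CF k) => x [].
    * by apply: Ck_sub (Ctau k) => x [].
- move=> q cq [Wq [Oq W'q]].
  have [c'fq Fcq] := repF q cq Wq.
  have dfq : chart_dom d (f q).
    have [z [c'z dz]] := Oq; rewrite -Fcq => /injc'.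
    by rewrite !inE => /(_ c'z c'fq) <-.
  have := W'q; rewrite /= -Fcq tauE// => W'dfq.
  by have [? ->] := repF' _ dfq W'dfq.
Qed.

Lemma smooth_at_comp (T T' T'' : atlasType R) (f : T -> T') (g : T' -> T'') p :
  is_manifold T' -> smooth_at f p -> smooth_at g (f p) ->
  smooth_at (fun x => g (f x)) p.
Proof.
move=> mT' [c [c' [W [F rf]]]] [d [d' [W' [F' rg]]]].
by exists c, d'; exact: local_rep_comp rf rg.
Qed.

Lemma Cinfty_id n (W : set 'rV[R]_n) : open W -> Cinfty W (fun x => x).
Proof.
move=> oW; case=> [|k]; first by move=> x _; exact: cvg_id.
split=> [x _|v]; first exact: ex_diff.
have -> : (fun x => 'D_v id x) = fun=> v by apply/funext => x; rewrite derive_id.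
exact: Ck_cst.
Qed.

Lemma local_rep_id (T : atlasType R) p (c : chart R T mdim) :
  atlas c -> chart_dom c p -> local_rep (fun x => x) p c c setT (fun x => x).
Proof.
move=> ac cp; split=> //; first by split=> //; exact: openT.
exact/Cinfty_id/openT.
Qed.

Lemma smooth_at_id (T : atlasType R) (p : T) :
  is_manifold T -> smooth_at (fun x => x) p.
Proof.
move=> [_ /(_ p)[c ac cp] _ _]; exists c, c, setT, (fun x => x).
exact: local_rep_id.
Qed.

(** Two smooth maps have to be read in the same chart at the source before
    they can be paired. *)
Lemma smooth_at_chart (T T' : atlasType R) (f : T -> T') p
    (c : chart R T mdim) :
  is_manifold T -> atlas c -> chart_dom c p -> smooth_at f p ->
  exists c' W F, local_rep f p c c' W F.
Proof.
move=> mT ac cp [d [d' [W [F rf]]]].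
by exists d'; exact: local_rep_comp (local_rep_id ac cp) rf.
Qed.

Lemma near_local_rep (T T' : atlasType R) (f g : T -> T') p c c' W F :
  is_manifold T -> (\forall x \near p, f x = g x) ->
  local_rep f p c c' W F -> exists W', local_rep g p c c' W' F.
Proof.
move=> mT; rewrite /prop_near1 nbhsE => -[B [oB Bp] fg] [[ac ac'] cp [oW Wp] CF repF].
have [_ _ /(_ c ac)[_ injc _ _] _] := mT.
exists (W `&` c @` (chart_dom c `&` B)); split=> //.
- split; first by apply: openI => //; exact: chart_open_image.
  by split=> //; exists p.
- by move=> k; apply: Ck_sub (CF k) => x [].
- move=> q cq [Wq [z [cz Bz] czq]].
  have zq : z = q by apply: injc; rewrite ?inE.
  by rewrite -fg; [exact: repF|rewrite -zq].
Qed.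

Lemma near_smooth_at (T T' : atlasType R) (f g : T -> T') p :
  is_manifold T -> (\forall x \near p, f x = g x) ->
  smooth_at f p -> smooth_at g p.
Proof.
move=> mT fg [c [c' [W [F /(near_local_rep mT fg)[W' rg]]]]].
by exists c, c', W', F.
Qed.

Lemma smooth_at_cst (T T' : atlasType R) (y : T') (p : T) :
  is_manifold T -> is_manifold T' -> smooth_at (fun=> y) p.
Proof.
move=> [_ /(_ p)[c ac cp] _ _] [_ /(_ y)[c' ac' cy] _ _].
exists c, c', setT, (fun=> c' y); split=> //.
- by split=> //; exact: openT.
- by move=> k; exact: Ck_cst.
Qed.

Lemma Ck_row_mx (V : normedModType R) k (W : set V) n m
    (f : V -> 'rV[R]_n) (g : V -> 'rV[R]_m) :
  open W -> Ck k W f -> Ck k W g -> Ck k W (fun x => row_mx (f x) (g x)).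
Proof.
move=> oW /(Ck_coord _ _ oW) Cf /(Ck_coord _ _ oW) Cg.
apply/Ck_coord => // j; case: (split_ordP j) => i ->.
  by under eq_fun do rewrite row_mxEl.
by under eq_fun do rewrite row_mxEr.
Qed.

Lemma Ck_lsubmx (V : normedModType R) k (W : set V) n m
    (f : V -> 'rV[R]_(n + m)) :
  open W -> Ck k W f -> Ck k W (fun x => lsubmx (f x)).
Proof.
move=> oW /(Ck_coord _ _ oW) Cf; apply/Ck_coord => // j.
by under eq_fun do rewrite mxE.
Qed.

Lemma Ck_rsubmx (V : normedModType R) k (W : set V) n m
    (f : V -> 'rV[R]_(n + m)) :
  open W -> Ck k W f -> Ck k W (fun x => rsubmx (f x)).
Proof.
move=> oW /(Ck_coord _ _ oW) Cf; apply/Ck_coord => // j.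
by under eq_fun do rewrite mxE.
Qed.

Lemma smooth_at_pair (T T1 T2 : atlasType R) (f : T -> T1) (g : T -> T2) p :
  is_manifold T -> smooth_at f p -> smooth_at g p ->
  smooth_at (fun x => (f x, g x)) p.
Proof.
move=> mT [c [c1 [W1 [F rf]]]] sg.
have [[ac ac1] cp [oW1 W1p] CF repF] := rf.
have [c2 [W2 [F' [[_ ac2] _ [oW2 W2p] CF' repF']]]] := smooth_at_chart mT ac cp sg.
exists c, (prod_chart c1 c2), (W1 `&` W2), (fun x => row_mx (F x) (F' x)).
have oW : open (W1 `&` W2) by exact: openI.
split=> //.
- by split=> //; exists c1, c2.
- move=> k; apply: Ck_row_mx => //.
    by apply: Ck_sub (CF k) => x [].
  by apply: Ck_sub (CF' k) => x [].
- move=> q cq [W1q W2q] /=.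
  by have [? ->] := repF q cq W1q; have [? ->] := repF' q cq W2q.
Qed.

Lemma local_rep_fst (T T' : atlasType R) (p : T * T')
    (c : chart R T mdim) (c' : chart R T' mdim) :
  atlas c -> atlas c' -> chart_dom c p.1 -> chart_dom c' p.2 ->
  local_rep (fst : T * T' -> T) p (prod_chart c c') c setT lsubmx.
Proof.
move=> ac ac' cp cp'; split=> //.
- by split=> //; exists c, c'.
- by split=> //; exact: openT.
- by move=> k; apply: Ck_lsubmx; [exact: openT|exact/Cinfty_id/openT].
- by move=> q [cq _] _; split=> //=; rewrite row_mxKl.
Qed.

Lemma local_rep_snd (T T' : atlasType R) (p : T * T')
    (c : chart R T mdim) (c' : chart R T' mdim) :
  atlas c -> atlas c' -> chart_dom c p.1 -> chart_dom c' p.2 ->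
  local_rep (snd : T * T' -> T') p (prod_chart c c') c' setT rsubmx.
Proof.
move=> ac ac' cp cp'; split=> //.
- by split=> //; exists c, c'.
- by split=> //; exact: openT.
- by move=> k; apply: Ck_rsubmx; [exact: openT|exact/Cinfty_id/openT].
- by move=> q [_ cq] _; split=> //=; rewrite row_mxKr.
Qed.

Lemma smooth_at_fst (T T' : atlasType R) (p : T * T') :
  is_manifold T -> is_manifold T' -> smooth_at (fst : T * T' -> T) p.
Proof.
move=> [_ /(_ p.1)[c ac cp] _ _] [_ /(_ p.2)[c' ac' cp'] _ _].
by exists (prod_chart c c'), c, setT, lsubmx; exact: local_rep_fst.
Qed.

Lemma smooth_at_snd (T T' : atlasType R) (p : T * T') :
  is_manifold T -> is_manifold T' -> smooth_at (snd : T * T' -> T') p.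
Proof.
move=> [_ /(_ p.1)[c ac cp] _ _] [_ /(_ p.2)[c' ac' cp'] _ _].
by exists (prod_chart c c'), c', setT, rsubmx; exact: local_rep_snd.
Qed.

Lemma row_mx_continuous n m :
  continuous (fun u : 'rV[R]_n * 'rV[R]_m => row_mx u.1 u.2).
Proof.
move=> [u v] A /nbhs_ballP[e /= e0 eA]; apply/nbhs_ballP; exists e => //= -[u' v'].
move=> [/= [_ uu'] [_ vv']]; apply: eA; split=> // i j.
case: (split_ordP j) => k ->; rewrite /= ?row_mxEl ?row_mxEr; [exact: uu'|exact: vv'].
Qed.

Lemma prod_chartP (T T' : topologicalType) n n' (c : chart R T n)
    (c' : chart R T' n') :
  is_chart c -> is_chart c' -> is_chart (prod_chart c c').
Proof.
move=> [oc injc cc imc] [oc' injc' cc' imc']; split.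
- rewrite openE => -[a b] [/= ca c'b].
  by exists (chart_dom c, chart_dom c'); first by split; exact: near_mem.
- move=> [a b] [a' b']; rewrite !inE /= => -[ca c'b] [ca' c'b'] /eq_row_mx[].
  by move=> /injc -> => [/injc' -> //|//|//]; rewrite inE.
- move=> [a b] [ca c'b].
  have c1 : {for (a, b), continuous (fun p : T * T' => c p.1)}.
    by apply: continuous_comp; [exact: cvg_fst|exact: cc].
  have c2 : {for (a, b), continuous (fun p : T * T' => c' p.2)}.
    by apply: continuous_comp; [exact: cvg_snd|exact: cc'].
  have cp : {for (a, b), continuous (fun p : T * T' => (c p.1, c' p.2))}.
    exact: cvg_pair c1 c2.
  exact: (continuous_comp cp (@row_mx_continuous _ _ (c a, c' b))).
- move=> O oO Odom; rewrite openE => _ [[a b] Oab <-].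
  have [ca c'b] := Odom _ Oab.
  have [[A B] [/= nA nB] ABO] : nbhs (a, b) O by exact: near_mem.
  move: nA nB; rewrite !nbhsE => -[A' [oA' A'a] A'A] [B' [oB' B'b] B'B].
  have oi : open (c @` (chart_dom c `&` A')) by apply: imc; [exact: openI|move=> x []].
  have oi' : open (c' @` (chart_dom c' `&` B')).
    by apply: imc'; [exact: openI|move=> x []].
  have n1 : nbhs (row_mx (c a) (c' b)) (lsubmx @^-1` (c @` (chart_dom c `&` A'))).
    apply: continuous_lsubmx; rewrite row_mxKl.
    by apply: near_mem => //; exists a.
  have n2 : nbhs (row_mx (c a) (c' b)) (rsubmx @^-1` (c' @` (chart_dom c' `&` B'))).
    apply: continuous_rsubmx; rewrite row_mxKr.
    by apply: near_mem => //; exists b.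
  rewrite /interior; apply: filterS2 n1 n2 => u [x [cx A'x] xu] [y [cy B'y] yu].
  exists (x, y); last by rewrite /= xu yu hsubmxK.
  by apply: ABO; split; [exact: A'A|exact: B'B].
Qed.

Lemma is_manifold_prod (T T' : atlasType R) :
  is_manifold T -> is_manifold T' -> is_manifold (T * T')%type.
Proof.
move=> [hT cT chT trT] [hT' cT' chT' trT']; split.
- move=> [a b] [a' b'] cl; congr pair.
    apply: hT => A B nA nB.
    have [||[x y] [[Ax _] [Bx _]]] := cl (A `*` setT) (B `*` setT); last by exists x.
      by exists (A, setT) => //; split=> //; exact: filterT.
    by exists (B, setT) => //; split=> //; exact: filterT.
  apply: hT' => A B nA nB.
  have [||[x y] [[_ Ay] [_ By]]] := cl (setT `*` A) (setT `*` B); last by exists y.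
    by exists (setT, A) => //; split=> //; exact: filterT.
  by exists (setT, B) => //; split=> //; exact: filterT.
- move=> [a b]; have [c ac ca] := cT a; have [c' ac' cb] := cT' b.
  by exists (prod_chart c c') => //; exists c, c'.
- by move=> _ [c [c' [ac ac' ->]]]; exact: prod_chartP (chT _ _) (chT' _ _).
- move=> _ _ [c [c' [ac ac' ->]]] [d [d' [ad ad' ->]]].
  have [F CF FE] := trT c d ac ad; have [F' CF' FE'] := trT' c' d' ac' ad'.
  exists (fun u => row_mx (F (lsubmx u)) (F' (rsubmx u))); last first.
    move=> [a b] [/= ca c'b] [/= da d'b].
    by rewrite row_mxKl row_mxKr FE// FE'.
  have chc := chT _ ac; have chc' := chT' _ ac'.
  have chd := chT _ ad; have chd' := chT' _ ad'.
  have oi1 : open (c @` (chart_dom c `&` chart_dom d)).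
    have [oc _ _ im] := chc; have [od _ _ _] := chd.
    by apply: im; [exact: openI|move=> x []].
  have oi2 : open (c' @` (chart_dom c' `&` chart_dom d')).
    have [oc _ _ im] := chc'; have [od _ _ _] := chd'.
    by apply: im; [exact: openI|move=> x []].
  set W := image _ _.
  have oW : open W.
    have [oe _ _ im] := prod_chartP chc chc'.
    have [oe' _ _ _] := prod_chartP chd chd'.
    by apply: im; [exact: openI|move=> x []].
  move=> k; apply: Ck_row_mx => //.
    apply: (Ck_comp _ oi1) (CF k) => //.
      move=> _ [[a b] [[/= ca _] [/= da _]] <-].
      by rewrite row_mxKl; exists a.
    by apply: Ck_lsubmx => //; exact: Cinfty_id.
  apply: (Ck_comp _ oi2) (CF' k) => //.
    move=> _ [[a b] [[/= _ cb] [/= _ db]] <-].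
    by rewrite row_mxKr; exists b.
  by apply: Ck_rsubmx => //; exact: Cinfty_id.
Qed.

Lemma smooth_at_fst_comp (T T1 T2 : atlasType R) (f : T -> T1 * T2) p :
  is_manifold T1 -> is_manifold T2 ->
  smooth_at f p -> smooth_at (fun x => (f x).1) p.
Proof.
move=> m1 m2 sf; apply: (smooth_at_comp _ sf); first exact: is_manifold_prod.
exact: smooth_at_fst.
Qed.

Lemma smooth_at_snd_comp (T T1 T2 : atlasType R) (f : T -> T1 * T2) p :
  is_manifold T1 -> is_manifold T2 ->
  smooth_at f p -> smooth_at (fun x => (f x).2) p.
Proof.
move=> m1 m2 sf; apply: (smooth_at_comp _ sf); first exact: is_manifold_prod.
exact: smooth_at_snd.
Qed.

End SmoothMaps.

Lemma smooth_at_continuous (R : realType) (T T' : atlasType R) (f : T -> T') p :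
  is_manifold T -> is_manifold T' -> smooth_at f p -> {for p, continuous f}.
Proof.
move=> [_ _ chT _] mT' [c [c' [W [F [[ac ac'] cp [oW Wp] CF repF]]]]] A.
rewrite /= nbhsE => -[B [oB Bfp] BA].
have [_ _ /(_ c' ac')[_ injc' _ _] _] := mT'.
have [oc _ /(_ p cp) cc _] := chT _ ac.
have [c'fp Fcp] := repF p cp Wp.
have oc'B := chart_open_image mT' ac' oB.
have nF : nbhs (c p) (F @^-1` (c' @` (chart_dom c' `&` B))).
  apply: (CF 0%N (c p) Wp); apply: near_mem => //.
  by rewrite -Fcp; exists (f p).
have n1 : \forall q \near p, (c' @` (chart_dom c' `&` B)) (F (c q)) := cc _ nF.
have n2 : \forall q \near p, W (c q) := cc _ (near_mem oW Wp).
have n3 : \forall q \near p, chart_dom c q := near_mem oc cp.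
suff : \forall q \near p, A (f q) by [].
apply: filterS3 n1 n2 n3 => q [z [c'z Bz] zq] Wq cq; apply: BA.
have [c'q Fq] := repF q cq Wq.
suff <- : z = f q by [].
by apply: injc'; rewrite ?inE// zq Fq.
Qed.

(** The local smooth extensions of f are composed with i; by continuity of i
    they agree with f along i near the given point. *)
Lemma smooth_partial_along (R : realType) (S T T' : atlasType R) (D : set T)
    (f : forall p, D p -> T') (i : S -> T) (Di : forall x, D (i x)) :
  is_manifold S -> is_manifold T -> smooth i -> smooth_partial f ->
  smooth (fun x => f (i x) (Di x)).
Proof.
move=> mS mT si sf x _; have [F sF Ff] := sf (i x) (Di x).
apply: (near_smooth_at (f := fun x => F (i x))) => //; last first.
  exact: (smooth_at_comp mT (si x Logic.I)).
have n : \forall y \near x, forall Dy : D (i y), F (i y) = f (i y) Dy.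
  exact: (smooth_at_continuous mS mT (si x Logic.I) Ff).
by apply: filterS n => y; exact.
Qed.

(** A variable S keeps neighbourhoods folded; those of a product would be
    unfolded to rectangles. *)
Lemma near_atlas (R : realType) (S : atlasType R) (p : S) (P : S -> Prop) :
  (forall q, P q) -> \forall q \near p, P q.
Proof. by move=> Pq; apply: filterE. Qed.

(** * Coproducts of open subsets of a manifold *)

Section Coproducts.
Variable R : realType.

Section CoprodTopology.
Variables (J : choiceType) (T : topologicalType) (V : J -> set T).
Implicit Types u v : coprod V.

Lemma coprod_eq u v :
  coprod_idx u = coprod_idx v -> coprod_pt u = coprod_pt v -> u = v.
Proof.
case: u v => i x [j y]; rewrite /coprod_idx /coprod_pt /= => ij.
by case: j / ij y => y /val_inj ->.
Qed.

Lemma coprod_inK u (h : V (coprod_idx u) (coprod_pt u)) : coprod_in h = u.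
Proof. exact: coprod_eq. Qed.

Lemma near_coprod_idx u : \forall v \near u, coprod_idx v = coprod_idx u.
Proof.
case: u => i x; pose e := existT (fun j => set_type (V j)) i.
have /near_mem : open (e @` setT : set (coprod V)).
  by apply: existT_open_map; exact: openT.
by move=> /(_ (e x)) n; apply: filterS (n _); [move=> _ [y _ <-]|exists x].
Qed.

Lemma coprod_pt_continuous : continuous (@coprod_pt J T V).
Proof.
case=> i x A nA.
exact: (@initial_continuous _ _ (set_val : V i -> T) x A nA).
Qed.

(** A copy of V j carries the topology induced from T, so a neighbourhood of
    u is cut out on the copy of u by a neighbourhood of its point. *)
Lemma nbhs_coprod u (A : set (coprod V)) : nbhs u A ->
  \forall x \near coprod_pt u, forall h : V (coprod_idx u) x, A (coprod_in h).
Proof.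
case: u => i x; rewrite /coprod_pt /coprod_idx /= => nA.
have : nbhs x (existT (fun j => set_type (V j)) i @^-1` A) by [].
rewrite nbhsE => -[B [[C oC CB] Bx] BA].
have Cx : C (set_val x) by move: Bx; rewrite -CB.
have : nbhs (set_val x) C by exact: near_mem.
apply: filterS => y Cy h; apply: BA; rewrite -CB /=.
by rewrite set_valE.
Qed.

End CoprodTopology.

Section CoprodManifold.
Variables (J : choiceType) (T : atlasType R) (V : J -> set T).
Hypothesis mT : is_manifold T.
Hypothesis oV : forall j, open (V j).

(** An open subset of the copy of V j is an open subset of T because V j is
    open; so its image under a chart of T is open. *)
Lemma coprod_chartP n j (c : chart R T n) :
  is_chart c -> is_chart (coprod_chart V j c).
Proof.
move=> [oc injc cc imc]; split.
- rewrite openE => u [ju cu]; rewrite /interior.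
  have h : \forall v \near u, chart_dom c (coprod_pt v).
    exact: (@coprod_pt_continuous _ _ _ u _ (near_mem oc cu)).
  by apply: filterS2 h (near_coprod_idx u) => v cv vu; split=> //; rewrite vu.
- move=> u v; rewrite !inE /= => -[ju cu] [jv cv] /injc.
  by rewrite !inE => /(_ cu cv); apply: coprod_eq; rewrite ju jv.
- move=> u [_ cu]; apply: continuous_comp; last exact: cc.
  exact: coprod_pt_continuous.
- move=> A oA Adom.
  pose B := V j `&` [set x | chart_dom c x /\ forall h : V j x, A (coprod_in h)].
  have -> : coprod_chart V j c @` A = c @` B.
    apply/seteqP; split=> [_ [u Au <-]|_ [x [Vx [cx Ax]] <-]]; last first.
      by exists (coprod_in Vx).
    have [ju cu] := Adom _ Au.
    exists (coprod_pt u) => //; split; first by rewrite -ju; exact: coprod_ptP.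
    split=> // h; rewrite (_ : coprod_in h = u)//.
    by apply: coprod_eq => //; rewrite ju.
  apply: imc => [|x [_ []]//].
  rewrite openE => x [Vx [cx Ax]]; rewrite /interior.
  have nA := nbhs_coprod (near_mem oA (Ax Vx)).
  have nV := near_mem (oV j) Vx.
  have nc := near_mem oc cx.
  by apply: filterS3 nA nV nc => y.
Qed.

(** Charts on different copies have no common point, so the transition maps of
    T serve for all pairs of charts. *)
Lemma is_manifold_coprod : is_manifold (coprod V).
Proof.
have [hT cT chT trT] := mT; split.
- move=> u v cl; apply: coprod_eq.
    have [w [<- <-//]] := cl _ _ (near_coprod_idx u) (near_coprod_idx v).
  apply: hT => A B nA nB.
  have [w [Aw Bw]] := cl _ _ (@coprod_pt_continuous _ _ _ u _ nA)
    (@coprod_pt_continuous _ _ _ v _ nB).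
  by exists (coprod_pt w).
- move=> u; have [c ac cu] := cT (coprod_pt u).
  by exists (coprod_chart V (coprod_idx u) c) => //; exists (coprod_idx u), c.
- by move=> _ [j [c ac ->]]; exact/coprod_chartP/chT.
- move=> _ _ [j [c ac ->]] [j' [c' ac' ->]].
  have [F CF FE] := trT c c' ac ac'; exists F => [k|u [_ cu] [_ c'u]].
    by apply: Ck_sub (CF k) => _ [u [[_ cu] [_ c'u]] <-]; exists (coprod_pt u).
  exact: FE.
Qed.

Lemma local_rep_coprod_pt (u : coprod V) (c : chart R T mdim) :
  atlas c -> chart_dom c (coprod_pt u) ->
  local_rep (@coprod_pt _ _ V) u (coprod_chart V (coprod_idx u) c) c setT
    (fun x => x).
Proof.
move=> ac cu; split=> //.
- by split=> //; exists (coprod_idx u), c.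
- by split=> //; exact: openT.
- exact/Cinfty_id/openT.
- by move=> v [].
Qed.

Lemma smooth_at_coprod_pt (u : coprod V) : smooth_at (@coprod_pt _ _ V) u.
Proof.
have [_ /(_ (coprod_pt u))[c ac cu] _ _] := mT.
by do 4!eexists; exact: local_rep_coprod_pt ac cu.
Qed.

(** The inclusion of V j as the copy of index j, made total by a default value
    since smoothness at a point speaks of total maps. *)
Definition coprod_at (u0 : coprod V) (j : J) (x : T) : coprod V :=
  if pselect (V j x) is left h then coprod_in h else u0.

Lemma coprod_atE u0 j x (h : V j x) : coprod_at u0 j x = coprod_in h.
Proof.
by rewrite /coprod_at; case: pselect => // h'; congr coprod_in; exact: Prop_irrelevance.
Qed.

Lemma local_rep_coprod_at u0 j x (c : chart R T mdim) :
  V j x -> atlas c -> chart_dom c x ->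
  exists W, local_rep (coprod_at u0 j) x c (coprod_chart V j c) W (fun y => y).
Proof.
move=> Vx ac cx; have oW := chart_open_image mT ac (oV j).
have [_ _ /(_ c ac)[_ injc _ _] _] := mT.
exists (c @` (chart_dom c `&` V j)); split=> //.
- by split=> //; exists j, c.
- by split=> //; exists x.
- exact: Cinfty_id.
- move=> y cy [z [cz Vz] czy].
  have zy : z = y by apply: injc; rewrite ?inE.
  by rewrite zy in Vz; rewrite (coprod_atE _ Vz).
Qed.

Lemma smooth_at_coprod_at u0 j x : V j x -> smooth_at (coprod_at u0 j) x.
Proof.
move=> Vx; have [_ /(_ x)[c ac cx] _ _] := mT.
have [W rf] := local_rep_coprod_at u0 Vx ac cx.
by do 4!eexists; exact: rf.
Qed.

End CoprodManifold.
End Coproducts.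

Lemma near_coprod_idx_comp (R : realType) (S T : atlasType R) (J : choiceType)
    (V : J -> set T) (f : S -> coprod V) p :
  {for p, continuous f} ->
  \forall q \near p, coprod_idx (f q) = coprod_idx (f p).
Proof. by move=> cf; exact: cf (near_coprod_idx (f p)). Qed.

Lemma diff_rsubmx (R : realType) n m (u v : 'rV[R]_(n + m)) :
  'd (rsubmx : 'rV[R]_(n + m) -> 'rV[R]_m) u v = rsubmx v.
Proof. by rewrite diff_lin//; exact: continuous_rsubmx. Qed.

Section Reindex.
Variables (R : realType) (J J' : choiceType) (T : atlasType R).
Variables (V : J -> set T) (V' : J' -> set T) (phi : J -> J').
Variable f : coprod V -> coprod V'.
Hypothesis fi : forall u, coprod_idx (f u) = phi (coprod_idx u).
Hypothesis fp : forall u, coprod_pt (f u) = coprod_pt u.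
Hypothesis mT : is_manifold T.

(** A map that keeps the point and changes the index only is the identity when
    both sides are read in the same chart of T. *)
Lemma local_rep_reindex u (d : chart R T mdim) :
  atlas d -> chart_dom d (coprod_pt u) ->
  local_rep f u (coprod_chart V (coprod_idx u) d)
    (coprod_chart V' (phi (coprod_idx u)) d) setT (fun x => x).
Proof.
move=> ad du; split=> //.
- by split; [exists (coprod_idx u), d|exists (phi (coprod_idx u)), d].
- by split=> //; exact: openT.
- exact/Cinfty_id/openT.
- by move=> v [vu dv] _; rewrite /= fi fp vu.
Qed.

Lemma smooth_reindex : smooth f.
Proof.
move=> u _; have [_ /(_ (coprod_pt u))[d ad du] _ _] := mT.
by do 4!eexists; exact: local_rep_reindex ad du.
Qed.

Lemma submersion_reindex : submersion f.
Proof.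
move=> u; have [_ /(_ (coprod_pt u))[d ad du] _ _] := mT.
do 4!eexists; split; first exact: local_rep_reindex ad du.
by move=> w; exists w; rewrite (@diff_val _ _ _ _ _ _ _ (is_diff_id _)).
Qed.

(** A submersion requires a representative with known differential; here it is
    the projection rsubmx. *)
Lemma submersion_reindex_snd (S : atlasType R) : is_manifold S ->
  submersion (fun r : S * coprod V => f r.2).
Proof.
move=> [_ mS _ _] [s u]; have [_ /(_ (coprod_pt u))[d ad du] _ _] := mT.
have [c ac cs] := mS s.
exists (prod_chart c (coprod_chart V (coprod_idx u) d)),
  (coprod_chart V' (phi (coprod_idx u)) d), setT, rsubmx; split; last first.
  move=> w; exists (row_mx 0%R w).
  exact: etrans (diff_rsubmx _ _) (row_mxKr _ _).
split=> //.
- split; last by exists (phi (coprod_idx u)), d.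
  by exists c, (coprod_chart V (coprod_idx u) d); split=> //; exists (coprod_idx u), d.
- by split=> //; exact: openT.
- by move=> k; apply: Ck_rsubmx; [exact: openT|exact/Cinfty_id/openT].
- by move=> v [cv [vu dv]] _; rewrite /= fi fp vu row_mxKr.
Qed.

End Reindex.

Section ChangeOpen.
Variables (R : realType) (J J' : choiceType) (T S : atlasType R).
Variables (V : J -> set T) (V' : J' -> set T).
Hypothesis mT : is_manifold T.
Hypothesis oV : forall j, open (V j).
Hypothesis oV' : forall j, open (V' j).

Lemma coprod_at_pt (u0 u : coprod V) j :
  coprod_idx u = j -> coprod_at u0 j (coprod_pt u) = u.
Proof. by move=> <-; rewrite (coprod_atE _ (coprod_ptP u)) coprod_inK. Qed.

(** Maps into a coproduct are defined on partial domains by a condition on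
    indices and point. Freezing the index at its value at p and letting the
    point move gives an extension to all arguments near p. *)
Lemma smooth_at_change_open (f : S -> coprod V) p (c : coprod V') :
  coprod_pt c = coprod_pt (f p) -> smooth_at f p ->
  smooth_at (fun x => coprod_at c (coprod_idx c) (coprod_pt (f x))) p.
Proof.
move=> cp sf; have mV := is_manifold_coprod mT oV.
have sp := smooth_at_comp mV sf (smooth_at_coprod_pt mT (f p)).
apply: (smooth_at_comp mT sp); apply: smooth_at_coprod_at => //.
by rewrite -cp; exact: coprod_ptP.
Qed.

End ChangeOpen.

(** * Crossed modules of Lie groups *)

Section CrossedModule.
Variables (R : realType) (G H : lieGroupType R) (X : crossed_module G H).

Lemma jmathMr h x y : jmath X h (x * y) = jmath X h x * jmath X h y.
Proof. by have [-> _ _] := jmath_aut X h. Qed.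

Lemma jmath_g1 h : jmath X h 1 = 1.
Proof. by apply: (mulgI (jmath X h 1)); rewrite -jmathMr !mulg1. Qed.

(** jmath 1 is idempotent and injective. *)
Lemma jmath1 g : jmath X 1 g = g.
Proof.
have [_ _ [f _ [fK _]]] := jmath_aut X 1.
by apply: (can_inj fK); rewrite -jmathM mulg1.
Qed.

Lemma jmathK h : cancel (jmath X h) (jmath X h^-1).
Proof. by move=> g; rewrite -jmathM mulVg jmath1. Qed.

Lemma jmathVK h : cancel (jmath X h^-1) (jmath X h).
Proof. by move=> g; rewrite -jmathM mulgV jmath1. Qed.

Lemma rho1 : rho X 1 = 1.
Proof. by apply: (mulgI (rho X 1)); rewrite -rhoM !mulg1. Qed.

End CrossedModule.

Section LieGroupSmooth.
Variables (R : realType) (G H : lieGroupType R) (X : crossed_module G H).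
Variables (T : atlasType R) (p : T).
Hypothesis mT : is_manifold T.

Lemma smooth_at_mulg (f g : T -> G) :
  smooth_at f p -> smooth_at g p -> smooth_at (fun x => f x * g x) p.
Proof.
move=> sf sg; apply: (smooth_at_comp (f := fun x => (f x, g x))
  (g := fun q : G * G => q.1 * q.2)).
- by apply: is_manifold_prod; exact: manifold_axiom.
- exact: smooth_at_pair.
- exact: smooth_mulg.
Qed.

Lemma smooth_at_invg (f : T -> G) :
  smooth_at f p -> smooth_at (fun x => (f x)^-1) p.
Proof.
move=> sf; apply: (smooth_at_comp (g := fun q : G => q^-1) _ sf).
- exact: manifold_axiom.
- exact: smooth_invg.
Qed.

Lemma smooth_at_jmath (f : T -> H) (g : T -> G) :
  smooth_at f p -> smooth_at g p -> smooth_at (fun x => jmath X (f x) (g x)) p.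
Proof.
move=> sf sg; apply: (smooth_at_comp (f := fun x => (f x, g x))
  (g := fun q : H * G => jmath X q.1 q.2)).
- by apply: is_manifold_prod; exact: manifold_axiom.
- exact: smooth_at_pair.
- exact: smooth_jmath.
Qed.

Lemma smooth_at_rho (f : T -> G) :
  smooth_at f p -> smooth_at (fun x => rho X (f x)) p.
Proof.
move=> sf; apply: (smooth_at_comp _ sf).
- exact: manifold_axiom.
- exact: smooth_rho.
Qed.

End LieGroupSmooth.

(** * Groupoids and the Cech groupoid *)

Section Composition.
Variables (A M : Type) (s t : A -> M) (D : groupoid_data s t).
Hypothesis ax : groupoid_axioms D.

(** Composition as a relation that carries its proof of composability:
    associativity can then be used without rewriting in the arguments of a
    dependent product. *)
Definition product_is a b c := exists e : t a = s b, gmul D e = c.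

Lemma gmul_product a b (e : t a = s b) : product_is a b (gmul D e).
Proof. by exists e. Qed.

Lemma product_isE a b c (e : t a = s b) : product_is a b c -> gmul D e = c.
Proof. by move=> [e' <-]; congr gmul; exact: Prop_irrelevance. Qed.

Lemma gmul_congr a b a' b' (e : t a = s b) (e' : t a' = s b') :
  a = a' -> b = b' -> gmul D e = gmul D e'.
Proof. by move=> ea eb; subst a' b'; congr gmul; exact: Prop_irrelevance. Qed.

Lemma product_is_inj a b c c' : product_is a b c -> product_is a b c' -> c = c'.
Proof. by move=> [e <-] /(product_isE e). Qed.

Lemma product_assocl a b c ab bc abc :
  product_is a b ab -> product_is b c bc -> product_is a bc abc ->
  product_is ab c abc.
Proof.
move=> [e <-] [e' <-] [f <-]; have f' : t (gmul D e) = s c.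
  by rewrite (tgt_mul ax).
by exists f'; rewrite (gmulA ax f f').
Qed.

Lemma product_assocr a b c ab bc abc :
  product_is a b ab -> product_is b c bc -> product_is ab c abc ->
  product_is a bc abc.
Proof.
move=> [e <-] [e' <-] [f <-]; have f' : t a = s (gmul D e').
  by rewrite (src_mul ax).
by exists f'; rewrite (gmulA ax f' f).
Qed.

Lemma product_unitr a : product_is a (gunit D (t a)) a.
Proof.
have e : t a = s (gunit D (t a)) by rewrite (src_unit ax).
by exists e; exact: (gmul1 ax).
Qed.

Lemma product_unitl a : product_is (gunit D (s a)) a a.
Proof.
have e : t (gunit D (s a)) = s a by rewrite (tgt_unit ax).
by exists e; exact: (g1mul ax).
Qed.

Lemma product_invl a : product_is (ginv D a) a (gunit D (t a)).
Proof.
have e : t (ginv D a) = s a by rewrite (tgt_inv ax).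
by exists e; exact: (gVmul ax).
Qed.

Lemma product_inv_uniq a b : product_is a b (gunit D (s a)) -> ginv D a = b.
Proof.
move=> ab; have [e _] := ab.
have := product_unitr (ginv D a); rewrite (tgt_inv ax) => u.
have := product_assocl (product_invl a) ab u; rewrite e => v.
exact: product_is_inj v (product_unitl b).
Qed.

End Composition.

Section CechGroupoid.
Variables (R : realType) (N : manifoldType R) (I : choiceType).
Variable U : I -> set N.

Lemma cech0P (m : cech0 U) : exists i x (hi : U i x), m = pt0 hi.
Proof.
by exists (coprod_idx m), (coprod_pt m), (coprod_ptP m); exact: coprod_eq.
Qed.

Lemma cech1P (c : cech1 U) :
  exists i j x (hi : U i x) (hj : U j x), c = pt1 hi hj.
Proof.
exists (coprod_idx c).1, (coprod_idx c).2, (coprod_pt c), (in_fst c), (in_snd c).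
by apply: coprod_eq => //; exact: surjective_pairing.
Qed.

(** Composability forces the middle index and the point to agree; this
    replaces an equation between elements of a coproduct by common variables. *)
Lemma cech_srcP (c : cech1 U) i j x (hi : U i x) (hj : U j x) :
  cech_tgt (pt1 hi hj) = cech_src c -> exists k (hk : U k x), c = pt1 hj hk.
Proof.
have [j' [k [y [hj' [hk ->]]]]] := cech1P c => e.
have jj' : j = j' := congr1 (@coprod_idx _ _ _) e.
have xy : x = y := congr1 (@coprod_pt _ _ _) e.
case: j' / jj' hj' e => hj' e; case: y / xy hj' hk e => hj' hk e.
by exists k, hk; exact: coprod_eq.
Qed.

Lemma cech_tgt_pt1 i j x (hi : U i x) (hj : U j x) :
  cech_tgt (pt1 hi hj) = pt0 hj.
Proof. exact: coprod_eq. Qed.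

Lemma cech_src_pt1 i j x (hi : U i x) (hj : U j x) :
  cech_src (pt1 hi hj) = pt0 hi.
Proof. exact: coprod_eq. Qed.

End CechGroupoid.

(** * The extension attached to a cocycle *)

Section ExtensionOf.
Variables (R : realType) (N : manifoldType R) (I : choiceType).
Variable U : I -> set N.
Variables (G H : lieGroupType R) (X : crossed_module G H).
Variable L : cocycle_data U G H.
Hypothesis cL : cocycle X L.
Local Notation lam hi hj := (clambda L (pt1 hi hj)).
Local Notation gam hi hj hk := (cg L (pt2 hi hj hk)).
Local Notation D := (ad_gpd (extension_of X L)).

Lemma cocycle_rho i j k x (hi : U i x) (hj : U j x) (hk : U k x) :
  rho X (gam hi hj hk) * lam hi hk = lam hi hj * lam hj hk.
Proof. by case: cL. Qed.

Lemma cocycle_gam i j k l x (hi : U i x) (hj : U j x) (hk : U k x)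
    (hl : U l x) :
  gam hi hj hk * gam hi hk hl =
  jmath X (lam hi hj) (gam hj hk hl) * gam hi hj hl.
Proof. by case: cL. Qed.

Lemma gam_iik i k x (hi : U i x) (hk : U k x) : gam hi hi hk = 1.
Proof. by case: cL. Qed.

(** The first identity for the indices i, i, i says that lambda_ii is
    idempotent. *)
Lemma lam_ii i x (hi : U i x) : lam hi hi = 1.
Proof.
by apply: (mulgI (lam hi hi)); rewrite -cocycle_rho gam_iik rho1 mul1g mulg1.
Qed.

(** The second identity for the indices i, j, j, j. *)
Lemma gam_ijj i j x (hi : U i x) (hj : U j x) : gam hi hj hj = 1.
Proof.
apply: (mulIg (gam hi hj hj)).
by rewrite cocycle_gam gam_iik jmath_g1.
Qed.

(** The second identity for the indices i, j, i, j. *)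
Lemma jmath_gam_jij i j x (hi : U i x) (hj : U j x) :
  jmath X (lam hi hj) (gam hj hi hj) = gam hi hj hi.
Proof. by have := cocycle_gam hi hj hi hj; rewrite gam_iik gam_ijj !mulg1. Qed.

Lemma jmath_lam i j k x (hi : U i x) (hj : U j x) (hk : U k x) g :
  jmath X (lam hi hj) (jmath X (lam hj hk) g) =
  gam hi hj hk * jmath X (lam hi hk) g * (gam hi hj hk)^-1.
Proof. by rewrite -jmathM -cocycle_rho jmathM jmath_rho. Qed.

(** The proof e depends on a and b, so these are variables constrained by
    equations: computed values can be supplied for them without rewriting
    inside the type of e. *)
Lemma ext_mulE a b (e : ext_tgt a = ext_src b) i j k x
    (hi : U i x) (hj : U j x) (hk : U k x) g g' :
  a = (g, pt1 hi hj) -> b = (g', pt1 hj hk) ->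
  gmul D e = (g * jmath X (lam hi hj) g' * gam hi hj hk, pt1 hi hk).
Proof.
move=> ea eb; subst a b; rewrite /=; congr (_ * cg L _, _); exact: coprod_eq.
Qed.

Lemma ext_invE a i j x (hi : U i x) (hj : U j x) g :
  a = (g, pt1 hi hj) ->
  ginv D a =
  (jmath X (lam hi hj)^-1 (g^-1 * (gam hi hj hi)^-1), pt1 hj hi).
Proof.
move=> ->; rewrite /=; congr (jmath X _ (_ * (cg L _)^-1), _); exact: coprod_eq.
Qed.

Lemma ext_unitE m i x (hi : U i x) : m = pt0 hi -> gunit D m = (1, pt1 hi hi).
Proof. by move=> ->; congr pair; exact: coprod_eq. Qed.

Lemma ext_starE a p (e : ext_tgt a = bundle_proj p) i j x
    (hi : U i x) (hj : U j x) g h :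
  a = (g, pt1 hi hj) -> p = (pt0 hj, h) ->
  ad_star (extension_of X L) e = (pt0 hi, rho X g * lam hi hj * h).
Proof. by move=> ea ep; subst a p; rewrite /=; congr pair; exact: coprod_eq. Qed.

Lemma ext_chiE p i x (hi : U i x) h g :
  p = (pt0 hi, h) -> ext_chi X p g = (jmath X h g, pt1 hi hi).
Proof. by move=> ->; congr pair; exact: coprod_eq. Qed.

Lemma ext_arrowP (a : ext_arrows U G) :
  exists i j x (hi : U i x) (hj : U j x) g, a = (g, pt1 hi hj).
Proof.
by case: a => g c; have [i [j [x [hi [hj ->]]]]] := cech1P c; exists i, j, x, hi, hj, g.
Qed.

Lemma ext_composableP (b : ext_arrows U G) i j x (hi : U i x) (hj : U j x)
    (g : G) :
  ext_tgt (g, pt1 hi hj) = ext_src b ->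
  exists k (hk : U k x) g', b = (g', pt1 hj hk).
Proof.
case: b => g' c e; have [k [hk ->]] : exists k (hk : U k x), c = pt1 hj hk.
  exact: cech_srcP e.
by exists k, hk, g'.
Qed.

Lemma ext_actionP (p : ext_bundle U H) i j x (hi : U i x) (hj : U j x) (g : G) :
  ext_tgt (g, pt1 hi hj) = bundle_proj p -> exists h, p = (pt0 hj, h).
Proof. by case: p => m h /= <-; exists h; congr pair; exact: coprod_eq. Qed.

(** Associativity is the second cocycle identity, once lambda_ij lambda_jk is
    replaced by rho(g_ijk) lambda_ik; the unit laws use lambda_ii = e and
    g_iik = g_ijj = e, and the left inverse uses lambda_ij(g_jij) = g_iji. *)
Lemma extension_groupoid_axioms : groupoid_axioms D.
Proof.
split.
- by move=> m; exact: coprod_eq.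
- by move=> m; exact: coprod_eq.
- by move=> a b e; exact: coprod_eq.
- move=> a b; have [i [j [x [hi [hj [g ->]]]]]] := ext_arrowP a => e.
  have [k [hk [g' eb]]] := ext_composableP e; subst b; exact: coprod_eq.
- by move=> a; exact: coprod_eq.
- by move=> a; exact: coprod_eq.
- move=> a b c; have [i [j [x [hi [hj [g1 ->]]]]]] := ext_arrowP a => e.
  have [k [hk [g2 eb]]] := ext_composableP e; subst b => e'.
  have [l [hl [g3 ec]]] := ext_composableP e'; subst c => f f'.
  rewrite (ext_mulE f erefl (ext_mulE e' erefl erefl)).
  rewrite (ext_mulE f' (ext_mulE e erefl erefl) erefl).
  congr pair; rewrite !jmathMr jmath_lam -!mulgA; do 4!congr (_ * _).
  by rewrite -cocycle_gam mulKg.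
- move=> a m; have [i [j [x [hi [hj [g ->]]]]]] := ext_arrowP a => e.
  have em : m = pt0 hj.
    by rewrite -(cech_tgt_pt1 hi hj) (e : cech_tgt _ = _); exact: coprod_eq.
  by rewrite (ext_mulE e erefl (ext_unitE em)) jmath_g1 gam_ijj !mulg1.
- move=> a m; have [i [j [x [hi [hj [g ->]]]]]] := ext_arrowP a => e.
  have em : m = pt0 hi.
    by rewrite -(cech_src_pt1 hi hj) -(e : _ = cech_src _); exact: coprod_eq.
  rewrite (ext_mulE e (ext_unitE em) erefl).
  by rewrite lam_ii jmath1 gam_iik mul1g mulg1.
- move=> a; have [i [j [x [hi [hj [g ->]]]]]] := ext_arrowP a => e.
  rewrite (ext_mulE e erefl (ext_invE erefl)) (ext_unitE (cech_src_pt1 hi hj)).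
  by rewrite jmathVK mulgA mulgV mul1g mulVg.
- move=> a; have [i [j [x [hi [hj [g ->]]]]]] := ext_arrowP a => e.
  rewrite (ext_mulE e (ext_invE erefl) erefl) (ext_unitE (cech_tgt_pt1 hi hj)).
  congr pair; apply: (can_inj (@jmathK _ _ _ X (lam hi hj))).
  rewrite !jmathMr !jmathVK jmath_lam jmath_gam_jij lam_ii jmath1 jmath_g1.
  by rewrite -!mulgA mulVg mulg1 mulKg mulVg.
Qed.

Lemma extension_star_assoc (P := @bundle_proj R N I U H) a a' p
    (haa : ext_tgt a = ext_src a') (hap : ext_tgt a' = P p)
    (h : ext_tgt (gmul D haa) = P p)
    (h' : ext_tgt a = P (ad_star (extension_of X L) hap)) :
  ad_star (extension_of X L) h = ad_star (extension_of X L) h'.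
Proof.
move: haa hap h h'; have [i [j [x [hi [hj [g1 ->]]]]]] := ext_arrowP a => e.
have [k [hk [g2 eb]]] := ext_composableP e; subst a' => e'.
have [k0 ep] := ext_actionP e'; subst p => f f'.
rewrite (ext_starE f (ext_mulE e erefl erefl) erefl).
rewrite (ext_starE f' erefl (ext_starE e' erefl erefl)).
congr pair; rewrite !rhoM rho_jmath -!mulgA; congr (_ * (_ * (_ * _))).
by rewrite [_ * (lam hi hk * _)]mulgA cocycle_rho -!mulgA mulKg.
Qed.

(** The factor g_iji created by the product with the inverse arrow cancels
    the one in the definition of this inverse. *)
Lemma extension_chi_equivariant a p (k : H) g
    (hap : ext_tgt a = bundle_proj p)
    (h : ext_tgt a = ext_src (ext_chi X p (jmath X k g)))
    (h' : ext_tgt (gmul D h) = ext_src (ginv D a)) :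
  ext_chi X (bundle_ract (ad_star (extension_of X L) hap) k) g = gmul D h'.
Proof.
move: hap h h'; have [i [j [x [hi [hj [a1 ->]]]]]] := ext_arrowP a => e.
have [h0 ep] := ext_actionP e; subst p => f f'.
have er : bundle_ract (ad_star (extension_of X L) e) k =
    (pt0 hi, rho X a1 * lam hi hj * h0 * k).
  by rewrite /bundle_ract (ext_starE e erefl erefl).
rewrite (ext_chiE _ er).
rewrite (ext_mulE f' (ext_mulE f erefl (ext_chiE _ erefl)) (ext_invE erefl)).
congr pair; rewrite jmathVK gam_ijj mulg1 !jmathM jmath_rho -!mulgA.
by rewrite mulVg mulg1.
Qed.

Lemma extension_chi_star p g (h : ext_tgt (ext_chi X p g) = bundle_proj p) :
  bundle_ract p (rho X g) = ad_star (extension_of X L) h.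
Proof.
move: p h => [m k]; have [i [x [hi ->]]] := cech0P m => e.
rewrite (ext_starE e (ext_chiE _ erefl) erefl) lam_ii mulg1 rho_jmath.
by rewrite -mulgA mulVg mulg1.
Qed.

End ExtensionOf.

Section Extension.
Variables (R : realType) (N : manifoldType R) (I : choiceType).
Variables (U : I -> set N) (hU : open_cover U).
Variables (G H : lieGroupType R) (X : crossed_module G H).

Let mN : is_manifold N := manifold_axiom.
Let mG : is_manifold G := manifold_axiom.
Let mH : is_manifold H := manifold_axiom.

Lemma open_double (ij : I * I) : open (U ij.1 `&` U ij.2).
Proof. by case: hU => oU _; exact: openI. Qed.

Lemma open_triple (ijk : I * I * I) : open (U ijk.1.1 `&` U ijk.1.2 `&` U ijk.2).
Proof. by case: hU => oU _; apply: openI => //; exact: openI. Qed.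

Lemma is_manifold_cech0 : is_manifold (cech0 U).
Proof. by case: hU => oU _; exact: is_manifold_coprod. Qed.

Lemma is_manifold_cech1 : is_manifold (cech1 U).
Proof. exact/is_manifold_coprod/open_double. Qed.

Lemma is_manifold_cech2 : is_manifold (cech2 U).
Proof. exact/is_manifold_coprod/open_triple. Qed.

Let m0 := is_manifold_cech0.
Let m1 := is_manifold_cech1.
Let m2 := is_manifold_cech2.

Lemma is_manifold_arrows : is_manifold (ext_arrows U G).
Proof. exact: is_manifold_prod. Qed.

Lemma is_manifold_bundle : is_manifold (ext_bundle U H).
Proof. exact: is_manifold_prod. Qed.

Let mA := is_manifold_arrows.
Let mP := is_manifold_bundle.

Lemma smooth_cech_src : smooth (@cech_src R N I U).
Proof. exact: (smooth_reindex (phi := fst)). Qed.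

Lemma smooth_cech_unit : smooth (gunit (cech_groupoid U)).
Proof. exact: (smooth_reindex (phi := fun i => (i, i))). Qed.

Lemma smooth_cech_inv : smooth (ginv (cech_groupoid U)).
Proof. exact: (smooth_reindex (phi := fun ij => (ij.2, ij.1))). Qed.

Lemma submersion_cech_src : submersion (@cech_src R N I U).
Proof. exact: (submersion_reindex (phi := fst)). Qed.

Lemma submersion_cech_tgt : submersion (@cech_tgt R N I U).
Proof. exact: (submersion_reindex (phi := snd)). Qed.

Lemma submersion_ext_src : submersion (@ext_src R N I U G).
Proof. exact: (submersion_reindex_snd (f := @cech_src _ _ _ _) (phi := fst)). Qed.

Lemma submersion_ext_tgt : submersion (@ext_tgt R N I U G).
Proof. exact: (submersion_reindex_snd (f := @cech_tgt _ _ _ _) (phi := snd)). Qed.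

Lemma submersion_ext_proj : submersion (@ext_proj R N I U G).
Proof. exact: (submersion_reindex_snd (f := id) (phi := id)). Qed.

Lemma cech_groupoid_axioms : groupoid_axioms (cech_groupoid U).
Proof.
split; try by move=> *; exact: coprod_eq.
- move=> a b; have [i [j [x [hi [hj ->]]]]] := cech1P a => e.
  by have [k [hk eb]] := cech_srcP e; subst b; exact: coprod_eq.
- move=> a m; have [i [j [x [hi [hj ->]]]]] := cech1P a => e.
  have em : m = pt0 hj by rewrite -(cech_tgt_pt1 hi hj) e; exact: coprod_eq.
  by subst m; exact: coprod_eq.
- move=> a m; have [i [j [x [hi [hj ->]]]]] := cech1P a => e.
  have em : m = pt0 hi by rewrite -(cech_src_pt1 hi hj) -e; exact: coprod_eq.
  by subst m; exact: coprod_eq.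
Qed.

Lemma smooth_cech_mul :
  smooth_partial (D := [set p : cech1 U * cech1 U | cech_tgt p.1 = cech_src p.2])
    (fun p h => gmul (cech_groupoid U) h).
Proof.
move=> p Dp; pose c := gmul (cech_groupoid U) Dp.
exists (fun q => coprod_at c (coprod_idx c) (coprod_pt q.1)).
  apply: (smooth_at_change_open mN open_double open_double (f := fst)) => //.
  exact: smooth_at_fst.
have k1 : {for p, continuous (fun q : cech1 U * cech1 U => q.1)}.
  exact: cvg_fst.
have k2 : {for p, continuous (fun q : cech1 U * cech1 U => q.2)}.
  exact: cvg_snd.
apply: filterS2 (near_coprod_idx_comp k1) (near_coprod_idx_comp k2).
move=> q q1 q2 Dq.
apply: (coprod_at_pt c (u := gmul (cech_groupoid U) Dq)).
exact: (congr2 (fun a b : I * I => (a.1, b.2)) q1 q2).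
Qed.

Lemma lie_groupoid_cech : lie_groupoid (cech_groupoid U).
Proof.
split; first by [].
split; first exact: cech_groupoid_axioms.
split.
- exact: submersion_cech_src.
- exact: submersion_cech_tgt.
- exact: smooth_cech_unit.
- exact: smooth_cech_inv.
- exact: smooth_cech_mul.
Qed.

Variable L : cocycle_data U G H.
Hypothesis cL : cocycle X L.
Let D := ad_gpd (extension_of X L).

Let smooth_lam : smooth (clambda L). Proof. by case: cL => -[]. Qed.
Let smooth_gam : smooth (cg L). Proof. by case: cL => -[]. Qed.

Lemma smooth_ext_unit : smooth (gunit D).
Proof.
move=> m _; apply: smooth_at_pair => //; first exact: smooth_at_cst.
exact: smooth_cech_unit.
Qed.

Lemma smooth_ext_inv : smooth (ginv D).
Proof.
move=> [g c] _; set p := (g, c).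
have s1 : smooth_at (fst : ext_arrows U G -> G) p by exact: smooth_at_fst.
have s2 : smooth_at (snd : ext_arrows U G -> cech1 U) p by exact: smooth_at_snd.
apply: smooth_at_pair => //; last first.
  exact: (smooth_at_comp m1 s2 (smooth_cech_inv Logic.I)).
apply: smooth_at_jmath => //.
  by apply: smooth_at_invg => //; exact: (smooth_at_comp m1 s2 (smooth_lam Logic.I)).
apply: smooth_at_mulg => //; first exact: smooth_at_invg.
apply: smooth_at_invg => //.
apply: (smooth_at_comp (f := fun r : ext_arrows U G =>
  pt2 (in_fst r.2) (in_snd r.2) (in_fst r.2)) m2 _ (smooth_gam Logic.I)).
apply: (smooth_at_comp m1 s2 (g := fun c : cech1 U =>
  pt2 (in_fst c) (in_snd c) (in_fst c))).
exact: (smooth_reindex (phi := fun ij => (ij.1, ij.2, ij.1))).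
Qed.

(** Near a composable pair over x_ij and x_jk all composable pairs have the
    same indices. The formula for the product with these indices frozen and
    the point read off the first arrow is a smooth extension. *)
Lemma smooth_ext_mul :
  smooth_partial
    (D := [set p : ext_arrows U G * ext_arrows U G | ext_tgt p.1 = ext_src p.2])
    (fun p h => gmul D h).
Proof.
move=> p Dp; set e : cech_tgt p.1.2 = cech_src p.2.2 := Dp.
pose c1 := pt1 (in_fst p.1.2) (in_last e).
pose c2 := pt2 (in_fst p.1.2) (in_snd p.1.2) (in_last e).
have s1 : smooth_at (fst : ext_arrows U G * ext_arrows U G -> _) p.
  exact: smooth_at_fst.
have s2 : smooth_at (snd : ext_arrows U G * ext_arrows U G -> _) p.
  exact: smooth_at_snd.
have s12 := smooth_at_snd_comp mG m1 s1.
exists (fun q => (q.1.1 * jmath X (clambda L q.1.2) q.2.1 *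
    cg L (coprod_at c2 (coprod_idx c2) (coprod_pt q.1.2)),
  coprod_at c1 (coprod_idx c1) (coprod_pt q.1.2))).
  have mAA : is_manifold (ext_arrows U G * ext_arrows U G)%type.
    exact: is_manifold_prod.
  apply: smooth_at_pair => //; last exact: (smooth_at_change_open mN open_double open_double).
  apply: smooth_at_mulg => //; last first.
    apply: (smooth_at_comp m2 _ (smooth_gam Logic.I)).
    exact: (smooth_at_change_open mN open_double open_triple).
  apply: smooth_at_mulg => //; first exact: (smooth_at_fst_comp mG m1 s1).
  apply: smooth_at_jmath => //; first exact: (smooth_at_comp m1 s12 (smooth_lam Logic.I)).
  exact: (smooth_at_fst_comp mG m1 s2).
have k1 : {for p, continuous
    (fun q : ext_arrows U G * ext_arrows U G => q.1.2)}.
  by apply: continuous_comp; [exact: cvg_fst|exact: cvg_snd].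
have k2 : {for p, continuous
    (fun q : ext_arrows U G * ext_arrows U G => q.2.2)}.
  by apply: continuous_comp; [exact: cvg_snd|exact: cvg_snd].
apply: filterS2 (near_coprod_idx_comp k1) (near_coprod_idx_comp k2).
move=> q q1 q2 Dq; set eq : cech_tgt q.1.2 = cech_src q.2.2 := Dq.
have -> : coprod_at c1 (coprod_idx c1) (coprod_pt q.1.2) =
    pt1 (in_fst q.1.2) (in_last eq).
  apply: (coprod_at_pt c1 (u := pt1 (in_fst q.1.2) (in_last eq))).
  exact: (congr2 (fun a b : I * I => (a.1, b.2)) q1 q2).
have -> : coprod_at c2 (coprod_idx c2) (coprod_pt q.1.2) =
    pt2 (in_fst q.1.2) (in_snd q.1.2) (in_last eq).
  apply: (coprod_at_pt c2
    (u := pt2 (in_fst q.1.2) (in_snd q.1.2) (in_last eq))).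
  exact: (congr2 (fun a b : I * I => (a.1, a.2, b.2)) q1 q2).
by [].
Qed.

Lemma lie_groupoid_ext : lie_groupoid D.
Proof.
split; first by [].
split; first exact: extension_groupoid_axioms.
split.
- exact: submersion_ext_src.
- exact: submersion_ext_tgt.
- exact: smooth_ext_unit.
- exact: smooth_ext_inv.
- exact: smooth_ext_mul.
Qed.

Lemma ext_is_extension :
  lie_groupoid_extension D (cech_groupoid U) (@ext_proj R N I U G).
Proof.
split.
- exact: lie_groupoid_ext.
- exact: lie_groupoid_cech.
- split=> //.
  + by move=> p _; exact: smooth_at_snd.
  + by move=> a a' h h'; exact: coprod_eq.
- exact: submersion_ext_proj.
- by move=> c; exists (1, c).
Qed.

Lemma ext_kernelE m (a : ext_arrows U G) :
  kernel_at (cech_groupoid U) (@ext_proj R N I U G) m a ->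
  a = (a.1, gunit (cech_groupoid U) m).
Proof. by case: a => g c ac; congr pair; exact: ac. Qed.

(** Over x_i the band map is jmath(h) followed by g -> (g, x_ii), which is
    multiplicative because lambda_ii and g_iii are trivial. *)
Lemma ext_chi_band p :
  band_at D (cech_groupoid U) (@ext_proj R N I U G) p.1 (ext_chi X p).
Proof.
case: p => m h; have [i [x [hi ->]]] := cech0P m.
split=> //.
- move=> g g' e.
  rewrite (ext_mulE X L e (ext_chiE X _ erefl) (ext_chiE X _ erefl)).
  rewrite (ext_chiE X _ erefl) (lam_ii cL) jmath1 (gam_iik cL).
  by rewrite jmathMr mulg1.
- move=> g _; apply: smooth_at_pair => //.
    by apply: smooth_at_jmath => //; [exact: smooth_at_cst|exact: smooth_at_id].
  exact: smooth_at_cst.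
- exists (fun a => jmath X h^-1 a.1); split.
  + by move=> g; exact: jmathK.
  + by move=> a /ext_kernelE ea; rewrite [RHS]ea /ext_chi jmathVK.
  + move=> a _; exists (fun a => jmath X h^-1 a.1); last by apply: near_atlas.
    by apply: smooth_at_jmath => //; [exact: smooth_at_cst|exact: smooth_at_fst].
Qed.

(** The global section x_i -> (x_i, e) of the bundle turns chi into a global
    trivialization of the kernel. *)
Lemma ext_kernel_locally_trivial :
  kernel_locally_trivial G D (cech_groupoid U) (@ext_proj R N I U G).
Proof.
move=> m; exists setT, (fun m => ext_chi X (m, 1)), fst; split.
- by split=> //; exact: openT.
- by move=> x _; exact: (ext_chi_band (x, 1)).
- move=> [x g] _.
  have s1 : smooth_at (fst : cech0 U * G -> _) (x, g) by exact: smooth_at_fst.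
  have mp : is_manifold (cech0 U * G)%type by exact: is_manifold_prod.
  apply: smooth_at_pair => //; last exact: (smooth_at_comp m0 s1 (smooth_cech_unit Logic.I)).
  by apply: smooth_at_jmath => //; [exact: smooth_at_cst|exact: smooth_at_snd].
- by move=> x g _; exact: jmath1.
- by move=> a _; exists fst; [exact: smooth_at_fst|apply: near_atlas].
Qed.

Lemma bundle_principal :
  principal_bundle (@bundle_proj R N I U H) (@bundle_ract R N I U H).
Proof.
have mPH : is_manifold (ext_bundle U H * H)%type by exact: is_manifold_prod.
have s1 q : smooth_at (fst : ext_bundle U H * H -> _) q by exact: smooth_at_fst.
split=> //.
- by move=> p _; exact: smooth_at_fst.
- move=> q _; apply: smooth_at_pair => //; first exact: (smooth_at_fst_comp m0 mH).
  by apply: smooth_at_mulg => //; [exact: (smooth_at_snd_comp m0 mH)|exact: smooth_at_snd].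
- by split=> [[m h]|p h h']; rewrite /bundle_ract /= ?mulg1 ?mulgA.
- move=> m; exists setT, snd, id; split=> //.
  + by split=> //; exact: openT.
  + by split=> p _; [exact: smooth_at_snd|exact: smooth_at_id].
  + by case.
Qed.

Lemma smooth_ext_star :
  smooth_partial
    (D := [set q : ext_arrows U G * ext_bundle U H | ext_tgt q.1 = bundle_proj q.2])
    (fun q h => ad_star (extension_of X L) h).
Proof.
move=> p Dp.
have mAP : is_manifold (ext_arrows U G * ext_bundle U H)%type.
  exact: is_manifold_prod.
have s1 : smooth_at (fst : ext_arrows U G * ext_bundle U H -> _) p.
  exact: smooth_at_fst.
have s2 : smooth_at (snd : ext_arrows U G * ext_bundle U H -> _) p.
  exact: smooth_at_snd.
have s12 := smooth_at_snd_comp mG m1 s1.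
exists (fun q => (cech_src q.1.2, rho X q.1.1 * clambda L q.1.2 * q.2.2)).
  apply: smooth_at_pair => //; first exact: (smooth_at_comp m1 s12 (smooth_cech_src Logic.I)).
  apply: smooth_at_mulg => //; last exact: (smooth_at_snd_comp m0 mH s2).
  apply: smooth_at_mulg => //; last exact: (smooth_at_comp m1 s12 (smooth_lam Logic.I)).
  by apply: smooth_at_rho => //; exact: (smooth_at_fst_comp mG m1 s1).
by apply: near_atlas.
Qed.

Lemma ext_principal_bundle_over :
  principal_bundle_over D (@bundle_ract R N I U H)
    (@ad_star _ _ _ _ _ _ (extension_of X L)).
Proof.
split; first exact: bundle_principal.
split=> //.
- move=> m [m' h] e.
  have [i [x [hi em]]] := cech0P m; subst m.
  have em' : m' = pt0 hi by rewrite -(e : _ = m'); exact: coprod_eq.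
  subst m'; rewrite (ext_starE X L e (ext_unitE X L erefl) erefl).
  by rewrite rho1 mul1g (lam_ii cL) mul1g.
- exact: (extension_star_assoc cL).
- exact: smooth_ext_star.
- by move=> a p k hap h; congr pair; rewrite /= mulgA.
Qed.

Lemma smooth_ext_chi :
  smooth (fun q : ext_bundle U H * G => ext_chi X q.1 q.2).
Proof.
move=> q _; have mPG : is_manifold (ext_bundle U H * G)%type by exact: is_manifold_prod.
have s1 : smooth_at (fst : ext_bundle U H * G -> _) q by exact: smooth_at_fst.
apply: smooth_at_pair => //.
  apply: smooth_at_jmath => //; first exact: (smooth_at_snd_comp m0 mH s1).
  exact: smooth_at_snd.
exact: (smooth_at_comp m0 (smooth_at_fst_comp m0 mH s1) (smooth_cech_unit Logic.I)).
Qed.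

Lemma extension_of_adapted : adapted_extension X (extension_of X L).
Proof.
split; last first.
  move=> i j x hi hj g g' e.
  by rewrite (ext_mulE X L e erefl erefl) (lam_ii cL) jmath1 (gam_iik cL) mulg1.
split.
- by split; [exact: ext_is_extension|exact: ext_kernel_locally_trivial].
- exact: ext_principal_bundle_over.
- split; [exact: ext_chi_band|exact: smooth_ext_chi|].
  by move=> a p k g hap h h'; exact: extension_chi_equivariant.
- by move=> p g h; exact: extension_chi_star.
Qed.

End Extension.

(** * The cocycle attached to an adapted extension *)

Section CocycleOf.
Variables (R : realType) (N : manifoldType R) (I : choiceType).
Variables (U : I -> set N) (hU : open_cover U).
Variables (G H : lieGroupType R) (X : crossed_module G H).
Variable E : adapted_data U G H.
Hypothesis hE : adapted_extension X E.
Local Notation D := (ad_gpd E).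
Local Notation lam hi hj := (clambda (cocycle_of E) (pt1 hi hj)).
Local Notation gam hi hj hk := (cg (cocycle_of E) (pt2 hi hj hk)).

Let ax : groupoid_axioms D.
Proof. by case: hE => -[[[[_ []]]]]. Qed.

Let lie : lie_groupoid D.
Proof. by case: hE => -[[[]]]. Qed.

Let bundle : principal_bundle_over D (@bundle_ract R N I U H) (@ad_star _ _ _ _ _ _ E).
Proof. by case: hE => -[]. Qed.

Let product := product_is D.
Definition action_is a p q := exists e : ext_tgt a = bundle_proj p, ad_star E e = q.

Lemma star_congr a p a' p' (e : ext_tgt a = bundle_proj p)
    (e' : ext_tgt a' = bundle_proj p') :
  a = a' -> p = p' -> ad_star E e = ad_star E e'.
Proof. by move=> ea ep; subst a' p'; congr ad_star; exact: Prop_irrelevance. Qed.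

Lemma action_isE a p q (e : ext_tgt a = bundle_proj p) :
  action_is a p q -> ad_star E e = q.
Proof. by move=> [e' <-]; congr ad_star; exact: Prop_irrelevance. Qed.

Lemma action_is_inj a p q q' : action_is a p q -> action_is a p q' -> q = q'.
Proof. by move=> [e <-] /(action_isE e). Qed.

Lemma action_assoc a b ab p bp abp :
  product a b ab -> action_is b p bp -> action_is a bp abp ->
  action_is ab p abp.
Proof.
have [_ [_ _ assoc _ _]] := bundle.
move=> [e <-] [e' <-] [f <-]; have f' : ext_tgt (gmul D e) = bundle_proj p.
  by rewrite (tgt_mul ax).
by exists f'; exact: assoc.
Qed.

Lemma product_proj a b c : product a b c ->
  forall e : cech_tgt a.2 = cech_src b.2, c.2 = gmul (cech_groupoid U) e.
Proof.
have [[[[_ _ [_ _ _ _ mor] _ _] _] _ _ _] _] := hE.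
by move=> [e <-] e'; exact: mor.
Qed.

Lemma adapted_product i j x (hi : U i x) (hj : U j x) g g' :
  product (g, pt1 hi hi) (g', pt1 hi hj) (g * g', pt1 hi hj).
Proof. by have [_ ad] := hE; exists (pt1_composable hi hi hj); exact: ad. Qed.

Lemma cocycle_of_product i j k x (hi : U i x) (hj : U j x) (hk : U k x) :
  product (1, pt1 hi hj) (1, pt1 hj hk) (gam hi hj hk, pt1 hi hk).
Proof.
have e : ext_tgt (1 : G, pt1 hi hj) = ext_src (1 : G, pt1 hj hk).
  exact: pt1_composable.
exists e; rewrite [LHS]surjective_pairing; congr pair.
  by rewrite /=; congr fst; apply: gmul_congr; congr pair; exact: coprod_eq.
rewrite (product_proj (gmul_product D e) (pt1_composable hi hj hk)).
exact: coprod_eq.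
Qed.

(** A unit is idempotent, and the only idempotent among the (g, x_ii) is
    (e, x_ii). *)
Lemma adapted_unit i x (hi : U i x) : gunit D (pt0 hi) = (1, pt1 hi hi).
Proof.
have [[[[_ _ [_ _ _ un _] _ _] _] _ _ _] _] := hE.
have u2 : (gunit D (pt0 hi)).2 = pt1 hi hi.
  by rewrite [LHS](un (pt0 hi)); exact: coprod_eq.
have uu := product_unitr ax (gunit D (pt0 hi)).
rewrite (tgt_unit ax) in uu; move: uu u2; case: (gunit D _) => u c uu /= ec.
subst c; have := product_is_inj uu (adapted_product hi hi u u).
by case=> /(congr1 (fun z => z * u^-1)); rewrite mulgK mulgV => ->.
Qed.

(** By equivariance it is enough to know the action on (x_j, e), where it is
    the definition of lambda. *)
Lemma action_lam i j x (hi : U i x) (hj : U j x) h :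
  action_is (1, pt1 hi hj) (pt0 hj, h) (pt0 hi, lam hi hj * h).
Proof.
have [_ [pi_act _ _ _ equiv]] := bundle.
have e0 : ext_tgt (1 : G, pt1 hi hj) = bundle_proj (pt0 hj, 1 : H).
  exact: coprod_eq.
have e : ext_tgt (1 : G, pt1 hi hj) = bundle_proj (pt0 hj, h).
  exact: coprod_eq.
exists e.
have e' : ext_tgt (1 : G, pt1 hi hj) = bundle_proj (bundle_ract (pt0 hj, 1) h).
  exact: coprod_eq.
have -> : ad_star E e = bundle_ract (ad_star E e0) h.
  rewrite -(equiv _ _ _ e0 e'); apply: star_congr => //.
  by rewrite /bundle_ract/= mul1g.
rewrite /bundle_ract; congr (_, _ * _).
  by rewrite [LHS](pi_act _ _ e0); exact: coprod_eq.
by rewrite /=; congr snd; apply: star_congr => //; congr pair; exact: coprod_eq.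
Qed.

(** The axiom p . rho(k) = chi(p)(k) . p at p = (x_i, h) and k = h^-1(g). *)
Lemma action_rho i x (hi : U i x) g h :
  action_is (g, pt1 hi hi) (pt0 hi, h) (pt0 hi, rho X g * h).
Proof.
have [[_ _ _ chistar] _] := hE.
have e : ext_tgt (g, pt1 hi hi) = bundle_proj (pt0 hi, h) by exact: coprod_eq.
have chiE : ext_chi X (pt0 hi, h) (jmath X h^-1 g) = (g, pt1 hi hi).
  by rewrite (ext_chiE X _ erefl) jmathVK.
exists e; have := chistar (pt0 hi, h) (jmath X h^-1 g); rewrite chiE => /(_ e) <-.
by rewrite /bundle_ract/= rho_jmath invgK !mulgA mulgV mul1g.
Qed.

Lemma action_formula i j x (hi : U i x) (hj : U j x) g h :
  action_is (g, pt1 hi hj) (pt0 hj, h) (pt0 hi, rho X g * lam hi hj * h).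
Proof.
have p := adapted_product hi hj g 1; rewrite mulg1 in p.
rewrite -mulgA; apply: action_assoc p (action_lam hi hj h) _.
exact: action_rho.
Qed.

(** The equivariance of chi for r = (e, x_ij) and p = (x_j, e) states that
    conjugation by r carries chi(p) to chi(r . p) = chi(x_i, lambda_ij). Multiplying
    by r on the right moves (g, x_jj) across r. *)
Lemma product_jmath i j x (hi : U i x) (hj : U j x) g :
  product (1, pt1 hi hj) (g, pt1 hj hj) (jmath X (lam hi hj) g, pt1 hi hj).
Proof.
have [[_ _ [_ _ conj] _] _] := hE.
set a : ext_arrows U G := (1, pt1 hi hj); set p : ext_bundle U H := (pt0 hj, 1).
have chi_p k : ext_chi X p k = (k, pt1 hj hj).
  by rewrite (ext_chiE X _ erefl) jmath1.
have [ep sp] : action_is a p (pt0 hi, lam hi hj).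
  by have := action_lam hi hj 1; rewrite mulg1.
have e : ext_tgt a = ext_src (ext_chi X p (jmath X 1 g)) by exact: coprod_eq.
have e' : ext_tgt (gmul D e) = ext_src (ginv D a).
  by rewrite (tgt_mul ax) (src_inv ax); exact: coprod_eq.
have := conj a p 1 g ep e e'.
rewrite sp (ext_chiE X (hi := hi) (h := lam hi hj)); last first.
  by rewrite /bundle_ract/= mulg1.
move=> ce; have := gmul_product D e'; rewrite -ce => pe'.
(* The product a (g, x_jj) equals (a (g, x_jj) a^-1) a. *)
have tac : ext_tgt (gmul D e) = ext_tgt a by rewrite (tgt_mul ax); exact: coprod_eq.
have := product_unitr ax (gmul D e); rewrite tac => u.
have := product_assocl ax pe' (product_invl ax a) u => ka.
have kE := product_is_inj (adapted_product hi hj (jmath X (lam hi hj) g) 1) ka.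
have ec : ext_tgt a = ext_src (g, pt1 hj hj) by exact: coprod_eq.
exists ec; rewrite -[jmath _ _ _]mulg1 kE; apply: gmul_congr => //.
by rewrite chi_p jmath1.
Qed.

(** Both arrows are factored, and (g', x_jj) is moved across (e, x_ij) in
    (g, x_ii) . (e, x_ij) . (g', x_jj) . (e, x_jk). *)
Lemma product_formula i j k x (hi : U i x) (hj : U j x) (hk : U k x) g g' :
  product (g, pt1 hi hj) (g', pt1 hj hk)
    (g * jmath X (lam hi hj) g' * gam hi hj hk, pt1 hi hk).
Proof.
have split1 m n (hm : U m x) (hn : U n x) u :
    product (u, pt1 hm hm) (1, pt1 hm hn) (u, pt1 hm hn).
  by have := adapted_product hm hn u 1; rewrite mulg1.
have left : product (g, pt1 hi hj) (g', pt1 hj hj)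
    (g * jmath X (lam hi hj) g', pt1 hi hj).
  apply: (product_assocl ax) (split1 _ _ hi hj g) (product_jmath hi hj g') _.
  exact: adapted_product.
have right : product (g * jmath X (lam hi hj) g', pt1 hi hj) (1, pt1 hj hk)
    (g * jmath X (lam hi hj) g' * gam hi hj hk, pt1 hi hk).
  apply: (product_assocl ax) (split1 _ _ hi hj _) (cocycle_of_product hi hj hk) _.
  exact: adapted_product.
exact: (product_assocr ax) left (split1 _ _ hj hk g') right.
Qed.

Let mN : is_manifold N := manifold_axiom.
Let mG : is_manifold G := manifold_axiom.
Let mH : is_manifold H := manifold_axiom.
Let m0 := is_manifold_cech0 hU.
Let m1 := is_manifold_cech1 hU.
Let m2 := is_manifold_cech2 hU.

Lemma smooth_cocycle_lam : smooth (clambda (cocycle_of E)).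
Proof.
have [_ [_ _ _ sm _]] := bundle.
(* lambda is the H-component of the action along c -> ((e, c), (t c, e)). *)
pose i (c : cech1 U) : ext_arrows U G * ext_bundle U H :=
  ((1, c), (cech_tgt c, 1)).
have mA := is_manifold_arrows hU G; have mP := is_manifold_bundle hU H.
have si : smooth i.
  move=> c _; have sc := smooth_at_id c m1.
  apply: smooth_at_pair => //; apply: smooth_at_pair => //; try exact: smooth_at_cst.
  exact: (smooth_reindex (phi := snd)).
have Di c : ext_tgt (i c).1 = bundle_proj (i c).2 by [].
have mAP := is_manifold_prod mA mP.
have ss := smooth_partial_along Di m1 mAP si sm.
move=> c _; have := smooth_at_snd_comp m0 mH (ss c Logic.I).
congr (smooth_at _ c); apply/funext => c'; congr snd.
by congr ad_star; exact: Prop_irrelevance.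
Qed.

Lemma smooth_cocycle_gam : smooth (cg (cocycle_of E)).
Proof.
have [_ [_ [_ _ _ _ sm]]] := lie.
pose pij (c : cech2 U) : cech1 U :=
  pt1 (proj1 (proj1 (coprod_ptP c))) (proj2 (proj1 (coprod_ptP c))).
pose pjk (c : cech2 U) : cech1 U :=
  pt1 (proj2 (proj1 (coprod_ptP c))) (proj2 (coprod_ptP c)).
pose i (c : cech2 U) : ext_arrows U G * ext_arrows U G := ((1, pij c), (1, pjk c)).
have mA := is_manifold_arrows hU G.
have si : smooth i.
  move=> c _.
  apply: smooth_at_pair => //; apply: smooth_at_pair => //; try exact: smooth_at_cst.
    exact: (smooth_reindex (phi := fun ijk => (ijk.1.1, ijk.1.2))).
  exact: (smooth_reindex (phi := fun ijk => (ijk.1.2, ijk.2))).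
have Di c : ext_tgt (i c).1 = ext_src (i c).2 by exact: pt1_composable.
have mAA := is_manifold_prod mA mA.
have ss := smooth_partial_along Di m2 mAA si sm.
move=> c _; have := smooth_at_fst_comp mG m1 (ss c Logic.I).
congr (smooth_at _ c); apply/funext => c'; congr fst.
by congr gmul; exact: Prop_irrelevance.
Qed.

(** The first identity compares the action of (e, x_ij) . (e, x_jk) on (x_k, e)
    with the successive actions of the factors; the second one computes
    (e, x_ij) . (e, x_jk) . (e, x_kl) in two ways. *)
Lemma cocycle_of_cocycle : cocycle X (cocycle_of E).
Proof.
split.
- by split; [exact: smooth_cocycle_lam|exact: smooth_cocycle_gam].
- move=> i j k x hi hj hk.
  have := action_assoc (cocycle_of_product hi hj hk) (action_lam hj hk 1)
    (action_lam hi hj _).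
  by move=> /(action_is_inj (action_formula hi hk _ 1)) []; rewrite !mulg1.
- move=> i j k l x hi hj hk hl.
  have := product_assocr ax (cocycle_of_product hi hj hk)
    (cocycle_of_product hj hk hl) (product_formula hi hk hl _ 1).
  move=> /(product_is_inj (product_formula hi hj hl 1 _)) [].
  by rewrite jmath_g1 mulg1 mul1g => ->.
- move=> i k x hi hk.
  have := product_is_inj (cocycle_of_product hi hi hk) (adapted_product hi hk 1 1).
  by case; rewrite mulg1.
Qed.

Lemma adapted_data_eq (E1 E2 : adapted_data U G H) :
  (forall m, gunit (ad_gpd E1) m = gunit (ad_gpd E2) m) ->
  (forall a b (e : ext_tgt a = ext_src b),
    gmul (ad_gpd E1) e = gmul (ad_gpd E2) e) ->
  (forall a, ginv (ad_gpd E1) a = ginv (ad_gpd E2) a) ->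
  (forall a p (e : ext_tgt a = bundle_proj p), ad_star E1 e = ad_star E2 e) ->
  E1 = E2.
Proof.
case: E1 E2 => [[u1 n1 v1] s1] [[u2 n2 v2] s2] /= /funext -> mm /funext -> ss.
have -> : n1 = n2.
  apply: functional_extensionality_dep => a.
  by apply: functional_extensionality_dep => b; apply: funext => e; exact: mm.
have -> // : s1 = s2.
apply: functional_extensionality_dep => a.
by apply: functional_extensionality_dep => p; apply: funext => e; exact: ss.
Qed.

(** The product and the action agree by the two formulas. The inverses then
    agree because they are determined by the product and the units. *)
Lemma extension_of_cocycle_of : extension_of X (cocycle_of E) = E.
Proof.
have cL := cocycle_of_cocycle.
have mulE a b (e : ext_tgt a = ext_src b) :
    gmul (ad_gpd (extension_of X (cocycle_of E))) e = gmul D e.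
  move: e; have [i [j [x [hi [hj [g ->]]]]]] := ext_arrowP a => e.
  have [k [hk [g' eb]]] := ext_composableP e; subst b.
  rewrite (product_isE e (product_formula hi hj hk g g')).
  exact: ext_mulE.
have unitE m : gunit (ad_gpd (extension_of X (cocycle_of E))) m = gunit D m.
  by have [i [x [hi ->]]] := cech0P m; rewrite adapted_unit; exact: ext_unitE.
apply: adapted_data_eq => //.
- move=> a; apply/esym/(product_inv_uniq ax).
  have axL := extension_groupoid_axioms cL.
  have e : ext_tgt a = ext_src (ginv (ad_gpd (extension_of X (cocycle_of E))) a).
    by rewrite (src_inv axL).
  by exists e; rewrite -mulE (gmulV axL) unitE.
- move=> a p; have [i [j [x [hi [hj [g ->]]]]]] := ext_arrowP a => e.
  have [h ep] := ext_actionP e; subst p.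
  by rewrite (action_isE e (action_formula hi hj g h)); exact: ext_starE.
Qed.

End CocycleOf.

Lemma cocycle_of_extension_of (R : realType) (N : manifoldType R)
    (I : choiceType) (U : I -> set N) (G H : lieGroupType R)
    (X : crossed_module G H) (L : cocycle_data U G H) :
  cocycle_of (extension_of X L) = L.
Proof.
case: L => l c; congr CocycleData; apply: funext => z /=.
  by rewrite rho1 mul1g mulg1.
rewrite jmath_g1 !mul1g; congr c; apply: coprod_eq => //.
by rewrite [RHS]surjective_pairing [_.1 in RHS]surjective_pairing.
Qed.

Theorem proposition1p3p12 (R : realType) (N : manifoldType R)
    (I : choiceType) (U : I -> set N) (hU : open_cover U)
    (G H : lieGroupType R) (X : crossed_module G H) :
  (forall E : adapted_data U G H, adapted_extension X E ->
    [/\ forall i j x (hi : U i x) (hj : U j x)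
          (e : ext_tgt (1%g, pt1 hi hj) = bundle_proj (pt0 hj, 1%g)),
          ad_star E e = (pt0 hi, clambda (cocycle_of E) (pt1 hi hj)),
        forall i j k x (hi : U i x) (hj : U j x) (hk : U k x)
          (e : ext_tgt (1%g, pt1 hi hj) = ext_src (1%g, pt1 hj hk)),
          gmul (ad_gpd E) e =
            (cg (cocycle_of E) (pt2 hi hj hk), pt1 hi hk) &
        cocycle X (cocycle_of E)]) /\
  (forall L : cocycle_data U G H, cocycle X L ->
    adapted_extension X (extension_of X L)) /\
  (forall E : adapted_data U G H, adapted_extension X E ->
    extension_of X (cocycle_of E) = E) /\
  (forall L : cocycle_data U G H, cocycle X L ->
    cocycle_of (extension_of X L) = L).
Proof.
split; [|split; [|split]].
- move=> E hE; split.
  + move=> i j x hi hj e.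
    by rewrite (action_isE e (action_lam hE hi hj 1)) mulg1.
  + move=> i j k x hi hj hk e.
    exact: product_isE e (cocycle_of_product hE hi hj hk).
  + exact: (cocycle_of_cocycle hU hE).
- by move=> L cL; exact: extension_of_adapted.
- by move=> E hE; exact: (extension_of_cocycle_of hU hE).
- by move=> L _; exact: cocycle_of_extension_of.
Qed.
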